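(* Let $d\ge 2$ and let $(T,o)$ be a unimodular random rooted tree of degree at most $d$. If the upper growth of $(T,o)$ is almost surely larger than $\sqrt{d-1}$, then almost surely the spine of $(T,o)$ has the same growth as $(T,o)$, in the sense that the upper growths coincide: $$\overline{\mathrm{gr}}(\mathrm{spine}(T))=\overline{\mathrm{gr}}(T).$$
   Context: For a connected graph $G$ of bounded degree and any vertex $o$ of $G$, the upper growth is $\overline{\mathrm{gr}}(G)=\limsup_{n\to\infty}|B_G(o,n)|^{1/n}$, where $B_G(o,n)$ is the set of vertices at graph distance at most $n$ from $o$; it does not depend on $o$. An edge $e$ of a tree $T$ is weak if one of the sides of $T\setminus e$ is finite; $\mathrm{spine}(T)$ is the unique infinite connected component of what remains of $T$ after removing all weak edges (equivalently, the union of all bi-infinite geodesics of $T$). A random rooted graph $(G,o)$ of degrees bounded by $d$ is a random element of the space of isomorphism classes of connected rooted graphs with degrees at most $d$ (with the local topology, given by isomorphism of balls around the root). It is unimodular if it satisfies the Mass Transport Principle: for every measurable non-negative function $F$ on (isomorphism classes of) triples $(G,x,y)$, with $G$ a bounded degree connected graph and $x,y\in V(G)$, one has $\mathbb E(\sum_{x\in V(G)}F(G,o,x))=\mathbb E(\sum_{x\in V(G)}F(G,x,o))$, provided one of the sides is finite. A unimodular random rooted tree is a unimodular random rooted graph that is almost surely a tree. *)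

(* Defs.v *)
From HB Require Import structures.
From mathcomp Require Import all_boot all_order all_algebra generic_quotient.
From mathcomp Require Import finmap.
From mathcomp Require Import all_classical all_reals all_analysis.

Set Implicit Arguments.
Unset Strict Implicit.
Unset Printing Implicit Defensive.

Import Order.TTheory GRing.Theory Num.Theory.
Import numFieldNormedType.Exports.

Local Open Scope card_scope.
Local Open Scope classical_set_scope.
Local Open Scope ring_scope.
Local Open Scope quotient_scope.

(** A connected graph of bounded degree is countable, so every isomorphism
    class of such graphs has a representative with vertices in [nat]. *)
Record sgraph := SGraph {
  vert : set nat;
  adj : rel nat;
  adj_sym : symmetric adj;
  adj_irr : irreflexive adj;
  adj_vert : forall x y, adj x y -> vert x
}.

Definition component (G : sgraph) (x : nat) : set nat :=
  [set y | vert G x /\ exists p : seq nat, path (adj G) x p /\ last x p = y].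

Definition ball (G : sgraph) (x n : nat) : set nat :=
  [set y | vert G x /\ exists p : seq nat,
     [/\ path (adj G) x p, last x p = y & (size p <= n)%N]].

Definition connected_graph (G : sgraph) : Prop :=
  forall x y, vert G x -> vert G y -> component G x y.

Definition degree_le (d : nat) (G : sgraph) : Prop :=
  forall x, vert G x -> [set y | adj G x y] #<= `I_d.

Definition is_tree (G : sgraph) : Prop :=
  connected_graph G /\
  forall c : seq nat, uniq c -> (2 < size c)%N -> ~~ cycle (adj G) c.

Section Subgraphs.
Variable G : sgraph.

Definition induced_adj (A : set nat) : rel nat :=
  [rel x y | [&& adj G x y, x \in A & y \in A]].

Fact induced_sym A : symmetric (induced_adj A).
Proof. by move=> x y; rewrite /induced_adj /= adj_sym [(x \in A) && _]andbC. Qed.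

Fact induced_irr A : irreflexive (induced_adj A).
Proof. by move=> x; rewrite /induced_adj /= adj_irr. Qed.

Fact induced_vert A x y : induced_adj A x y -> (vert G `&` A) x.
Proof. by move=> /and3P[/adj_vert Gx /set_mem Ax _]. Qed.

Definition induced (A : set nat) : sgraph :=
  SGraph (induced_sym A) (induced_irr A) (@induced_vert A).

(** An edge is removed as soon as [D] holds of one of its orientations. *)
Definition del_adj (D : rel nat) : rel nat :=
  [rel x y | [&& adj G x y, ~~ D x y & ~~ D y x]].

Fact del_sym D : symmetric (del_adj D).
Proof. by move=> x y; rewrite /del_adj /= adj_sym [~~ D x y && _]andbC. Qed.

Fact del_irr D : irreflexive (del_adj D).
Proof. by move=> x; rewrite /del_adj /= adj_irr. Qed.

Fact del_vert D x y : del_adj D x y -> vert G x.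
Proof. by move=> /and3P[/adj_vert]. Qed.

Definition del_edges (D : rel nat) : sgraph :=
  SGraph (del_sym D) (del_irr D) (@del_vert D).

(** The side of the edge [xy] containing [x]. *)
Definition side (x y : nat) : set nat :=
  component (del_edges [rel u v | (u == x) && (v == y)]) x.

Definition weak_edge : rel nat :=
  [rel x y | adj G x y && `[< finite_set (side x y) \/ finite_set (side y x) >]].

End Subgraphs.

(** A tree has at most one infinite component left after removing its weak
    edges, so the vertices lying in an infinite component are those of the
    unique one; the spine is the empty graph if there is none. *)
Definition spine (G : sgraph) : sgraph :=
  let S := del_edges G (weak_edge G) in
  induced S [set x | infinite_set (component S x)].

Definition growth_from (R : realType) (G : sgraph) (x : nat) : \bar R :=
  limn_esup (fun n => ((#|` fset_set (ball G x n)|%:R : R) `^ n%:R^-1)%:E).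

(** For connected graphs of bounded degree, [growth_from R G x] does not depend
    on the vertex [x]. The balls of the empty graph are empty, so its growth is
    0, whereas that of a nonempty graph is at least 1. *)
Definition upper_growth (R : realType) (G : sgraph) : \bar R :=
  growth_from R G (get (vert G)).

Record cgraph (d : nat) := CGraph {
  cgraph_graph :> sgraph;
  cgraph_connected : connected_graph cgraph_graph;
  cgraph_degree : degree_le d cgraph_graph
}.

(** Connected graphs with [k.+1] marked vertices, the first one being the root:
    pairs [(G, o)] for [k = 0] and triples [(G, x, y)] for [k = 1]. *)
Record marked_graph (d k : nat) := MarkedGraph {
  marked_base :> cgraph d;
  marks : k.+1.-tuple (set_type (vert marked_base))
}.

Definition root (d k : nat) (G : marked_graph d k) : set_type (vert G) :=
  thead (marks G).

Definition mark_seq (d k : nat) (G : marked_graph d k) : seq nat :=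
  map val (marks G).

Definition marked_iso (G : sgraph) (s : seq nat) (H : sgraph) (t : seq nat) :=
  exists f : nat -> nat, [/\ set_bij (vert G) (vert H) f,
    forall x y, vert G x -> vert G y -> adj H (f x) (f y) = adj G x y
    & map f s = t].

Section MarkedClass.
Variables d k : nat.

HB.instance Definition _ := gen_eqMixin (marked_graph d k).
HB.instance Definition _ := gen_choiceMixin (marked_graph d k).

Definition isomorphic : rel (marked_graph d k) :=
  fun G H => `[< marked_iso G (mark_seq G) H (mark_seq H) >].

Fact isomorphic_refl : reflexive isomorphic.
Proof.
move=> G; apply/asboolP; exists id; split => //; last by rewrite map_id.
by split => // x Gx; exists x.
Qed.

Fact isomorphic_sym : symmetric isomorphic.
Proof.
suff sub G H : isomorphic G H -> isomorphic H G.
  by move=> G H; apply/idP/idP; exact: sub.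
move=> /asboolP[f [[fGH finj fsurj] fadj fm]]; apply/asboolP.
have [g gP] : exists g : nat -> nat, forall y, vert H y -> vert G (g y) /\ f (g y) = y.
  suff /choice[g gP] : forall y, exists x, vert H y -> vert G x /\ f x = y.
    by exists g.
  move=> y; case: (pselect (vert H y)) => [/fsurj[x Gx <-]|nHy].
    by exists x.
  by exists 0%N => /nHy.
have fK x : vert G x -> g (f x) = x.
  move=> Gx; have [Gg fg] := gP _ (fGH _ Gx).
  by apply: finj => //; exact/mem_set.
exists g; split.
- split.
  + by move=> y /gP[].
  + move=> y z /set_mem Hy /set_mem Hz gyz.
    by rewrite -(gP _ Hy).2 -(gP _ Hz).2 gyz.
  + by move=> x Gx; exists (f x); [exact: fGH | exact: fK].
- move=> x y Hx Hy; have [[Gx fx] [Gy fy]] := (gP _ Hx, gP _ Hy).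
  by rewrite -fadj // fx fy.
- rewrite -fm -map_comp -[RHS]map_id; apply/eq_in_map.
  by move=> _ /mapP[x _ ->] /=; rewrite fK //; exact: set_valP.
Qed.

Fact isomorphic_trans : transitive isomorphic.
Proof.
move=> G F H /asboolP[f [fb fadj fm]] /asboolP[g [gb gadj gm]]; apply/asboolP.
exists (g \o f); split; first exact: (set_bij_comp fb gb).
- move=> x y Fx Fy /=; have [fFG _ _] := fb.
  by rewrite gadj ?fadj//; exact: fFG.
- by rewrite map_comp fm gm.
Qed.

Canonical isomorphic_equiv :=
  EquivRel isomorphic isomorphic_refl isomorphic_sym isomorphic_trans.

Definition marked_class := {eq_quot isomorphic}.

HB.instance Definition _ := Choice.on marked_class.
HB.instance Definition _ := EqQuotient.on marked_class.

Fact vertex_sym : symmetric (fun _ _ : nat => false). Proof. by []. Qed.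
Fact vertex_irr : irreflexive (fun _ _ : nat => false). Proof. by []. Qed.
Fact vertex_vert (x y : nat) : false -> [set 0%N] x. Proof. by []. Qed.

Definition one_vertex := SGraph vertex_sym vertex_irr vertex_vert.

Fact one_vertex_connected : connected_graph one_vertex.
Proof. by move=> x y -> ->; split => //; exists [::]. Qed.

Fact one_vertex_degree : degree_le d one_vertex.
Proof.
move=> x _; have -> : [set y | adj one_vertex x y] = set0 by apply/seteqP; split.
exact: card_ge0.
Qed.

Definition one_vertex_cgraph := CGraph one_vertex_connected one_vertex_degree.

Definition one_vertex_root : set_type (vert one_vertex_cgraph) :=
  SigSub (mem_set (erefl 0%N : vert one_vertex_cgraph 0%N)).

HB.instance Definition _ := isPointed.Build marked_class
  (\pi_marked_class (MarkedGraph [tuple of nseq k.+1 one_vertex_root])).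

(** [agree r G H]: the balls of radius [r] around the roots contain all the
    marks and are isomorphic as marked graphs. *)
Definition agree (r : nat) (G H : marked_graph d k) : Prop :=
  let BG := ball G (val (root G)) r in
  let BH := ball H (val (root H)) r in
  [/\ forall x, x \in mark_seq G -> BG x,
       forall x, x \in mark_seq H -> BH x
     & marked_iso (induced G BG) (mark_seq G) (induced H BH) (mark_seq H)].

Definition cylinder (i : marked_class * nat) : set marked_class :=
  [set c | agree i.2 (repr i.1) (repr c)].

(** The local topology. *)
HB.instance Definition _ := @isSubBaseTopological.Build marked_class
  (marked_class * nat)%type setT cylinder.

Definition borel_class := g_sigma_algebraType (@open marked_class).

HB.instance Definition _ := Measurable.on borel_class.

End MarkedClass.

Notation rooted_class d := (borel_class d 0).
Notation birooted_class d := (borel_class d 1).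

Definition graph_of (d : nat) (c : rooted_class d) : marked_graph d 0 :=
  repr (c : marked_class d 0).

Definition birooted (d : nat) (G : cgraph d) (x y : set_type (vert G)) :
    birooted_class d :=
  \pi_(marked_class d 1) (MarkedGraph [tuple x; y]).

(** Mass Transport Principle for the random rooted graph [X]. *)
Definition unimodular (R : realType) (d : nat) (disp : measure_display)
    (Omega : measurableType disp) (P : probability Omega R)
    (X : Omega -> rooted_class d) : Prop :=
  forall F : birooted_class d -> R,
    measurable_fun setT F -> (forall c, 0 <= F c) ->
    let sent := (\int[P]_w \esum_(x in [set: set_type (vert (graph_of (X w)))])
      (F (birooted (root (graph_of (X w))) x))%:E)%E in
    let received := (\int[P]_w \esum_(x in [set: set_type (vert (graph_of (X w)))])
      (F (birooted x (root (graph_of (X w)))))%:E)%E in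
    (sent < +oo)%E \/ (received < +oo)%E -> sent = received.

(* Main.v *)
Require Import Defs.
From HB Require Import structures.
From mathcomp Require Import all_boot all_order all_algebra.
From mathcomp Require Import finmap.
From mathcomp Require Import all_classical all_reals all_analysis.
From mathcomp Require Import measurable_realfun lra zify.

(** Let [q = d - 1], [s > sqrt q] and [z = 1 / s]. On functions of the vertices of a tree
    of degree at most [d] consider the operator

      (H f)(x) = (sum of f(w) over the neighbours w of x) + z (d - deg x) f(x),

    and let [lam = s + q / s]. The potential makes up for the missing edges: for every
    vertex [y] the function [z^dist(x,y)] of [x] satisfies [H f <= lam f], with equality
    off [y]. Hence the number of vertices at distance [n] and the iterates of [H] control
    each other: a set with at most [s0^n] points at distance [n], [s0 < s], contributes at
    most a multiple of [lam^j] to [H^j] ([iterHop_indic_le]), and conversely, for [s' > s],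
    a bound on the sum over [j] of [H^j 1 / lam'^j], [lam' = s' + q / s'], bounds the sphere
    of radius [n] by a multiple of [s'^n] ([sphere_le]). The converse uses [lam < lam'],
    that is, that [s + q / s] increases for [s > sqrt q].

    By the mass transport principle [H] is symmetric for the form
    [<f, g> = E (f(o) g(o))] ([Hop_sym]). As for a self-adjoint operator, if the moments
    [<u, H^j u>] of a function [0 <= u <= 1] are at most [C lam^j], then they are at most
    [lam^j] ([moments_le]). This removes all constants, which is what allows to pass from a
    part of the tree to the whole tree.

    Suppose that the spine is not empty and grows slower than [s]. There is a function
    [seed], positive at some vertex of the spine, whose moments are at most [lam^j]. Since
    [H] is positive, spreading [seed] to the vertices within distance [m] gives functions
    with moments at most [C_m lam^j], hence at most [lam^j]. Letting [m] go to infinity,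
    the moments of the constant function [1] are at most [lam^j], and the tree grows almost
    surely no faster than any [s' > s] ([sphere_bound_ae]).

    If the spine of an infinite tree is empty, then every vertex has exactly one edge towards
    infinity. Functions which are multiplied by [s] along every step to infinity are then
    eigenfunctions of [H] with eigenvalue [lam], and a Schur test with mass transport shows
    that [H] has norm at most [lam] ([coreless_step]). So the growth is at most [s] for all
    [s > sqrt q], and such trees are excluded by the hypothesis.

    The spine never grows faster than the tree, so the two growths agree.

    To apply the mass transport principle, the functions above have to be measurable
    functions of the isomorphism class. They are built from constants by sums over
    neighbours, continuous operations and pointwise limits; all of these preserve the class
    [baire] of iterated limits of local functionals, which are measurable
    ([measurable_rval], [measurable_bival]). Whether a vertex belongs to the spine is such a
    limit ([core_tree]). *)

Set Implicit Arguments.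
Unset Strict Implicit.
Unset Printing Implicit Defensive.

Import Order.TTheory GRing.Theory Num.Theory.
Import numFieldNormedType.Exports.

Local Open Scope ring_scope.

(* The notions for graphs, not metric balls, induced charges and roots of polynomials. *)
Local Notation ball := Defs.ball.
Local Notation induced := Defs.induced.
Local Notation root := Defs.root.

(** * Simple paths and distances in trees *)

Section SimplePaths.
Local Open Scope classical_set_scope.

Definition upath (G : sgraph) (x : nat) (p : seq nat) (y : nat) : Prop :=
  [/\ path (adj G) x p, uniq (x :: p) & last x p = y].

Lemma adj_vertr (G : sgraph) x y : adj G x y -> vert G y.
Proof. by rewrite adj_sym => /adj_vert. Qed.

Lemma path_vert (G : sgraph) x p : vert G x -> path (adj G) x p ->
  forall y, y \in x :: p -> vert G y.
Proof.
elim: p x => [|a p IH] x Gx /=; first by move=> _ y; rewrite inE => /eqP ->.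
move=> /andP[xa ap] y; rewrite inE => /orP[/eqP -> //|].
exact: IH (adj_vertr xa) ap y.
Qed.

Lemma upath_component (G : sgraph) x y :
  component G x y -> exists p, upath G x p y.
Proof.
move=> [_ [p [xp <-]]]; case: (shortenP xp) => p' xp' up' _.
by exists p'.
Qed.

Lemma upath_rev (G : sgraph) x p y :
  upath G x p y -> upath G y (rev (belast x p)) x.
Proof.
move=> [xp up <-]; split.
- by rewrite rev_path (eq_path (e' := adj G)) // => u v; rewrite adj_sym.
- by rewrite -rev_rcons -lastI rev_uniq.
- by case: p {xp up} => //= a p; rewrite rev_cons last_rcons.
Qed.

Lemma upath_cons (G : sgraph) x a p y : adj G x a -> x \notin a :: p ->
  upath G a p y -> upath G x (a :: p) y.
Proof.
by move=> xa xN [ap uap lp]; split => //=; [rewrite xa | rewrite xN].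
Qed.

Lemma upath_behead (G : sgraph) x a p y : upath G x (a :: p) y ->
  [/\ adj G x a, x \notin a :: p & upath G a p y].
Proof. by move=> [/= /andP[xa ap] /andP[xN ua] lp]; split. Qed.

Lemma upath_prefix (G : sgraph) x p y z : upath G x p y -> z \in p ->
  exists p1 p2, [/\ p = p1 ++ p2, upath G x p1 z & upath G z p2 y].
Proof.
move=> [xp up lp] zp; case/path.splitP: zp xp up lp => p1 p2.
rewrite cat_path last_rcons => /andP[xp1 zp2] up lp.
exists (rcons p1 z), p2; split => //.
- split => //; last by rewrite last_rcons.
  by move: up; rewrite -cat_cons cat_uniq => /and3P[].
- split => //; last by rewrite -lp last_cat last_rcons.
  move: up; rewrite /= -cats1 -catA /= => /andP[_].
  by rewrite cat_uniq => /and3P[_ _].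
Qed.

End SimplePaths.

Section Trees.
Local Open Scope classical_set_scope.
Variables (G : sgraph) (tG : is_tree G).

Lemma upath_ex x y : vert G x -> vert G y -> exists p, upath G x p y.
Proof. by move=> Gx Gy; apply: upath_component; exact: tG.1. Qed.

Lemma upath_uniq x p p' y : upath G x p y -> upath G x p' y -> p = p'.
Proof.
elim: p p' x => [|a p IH] [|b p'] x //.
- move=> [_ _ /= <-] [_ /= /andP[xN _] lx].
  by move: (mem_last b p'); rewrite lx (negPf xN).
- move=> [_ /= /andP[xN _] lx] [_ _ /= xy].
  by move: (mem_last a p); rewrite lx -xy (negPf xN).
move=> xp xp'.
have [eq_ab|neq_ab] := eqVneq a b.
  move: xp' ; rewrite -eq_ab => xp'.
  have [_ _ ap] := upath_behead xp; have [_ _ ap'] := upath_behead xp'.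
  by rewrite (IH p' a).
(* The paths leave [x] through different neighbours [a] and [b]; a walk from [a] to [b]
   through [y] avoids [x], and its shortening closes up to a cycle through [x]. *)
exfalso.
have [xa xNp ap] := upath_behead xp; have [xb xNp' bp'] := upath_behead xp'.
have [yp' _ lb] := upath_rev bp'.
case: ap => app uap la.
have lp : path (adj G) a (p ++ rev (belast b p')) by rewrite cat_path app la.
have ll : last a (p ++ rev (belast b p')) = b by rewrite last_cat la.
have sub : {subset a :: (p ++ rev (belast b p')) <= (a :: p) ++ (b :: p')}.
  move=> u; rewrite -cat_cons !mem_cat => /orP[-> //|].
  by rewrite mem_rev => /mem_belast ->; rewrite orbT.
case: (shortenP lp) ll => c ac uc csub lc.
have xNc : x \notin a :: c.
  apply/negP => xc.
  have : x \in a :: (p ++ rev (belast b p')).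
    move: xc; rewrite !inE => /orP[-> //|/csub ->]; exact: orbT.
  move=> /sub; rewrite mem_cat => /orP[]; [exact/negP|exact/negP].
have cyc : cycle (adj G) [:: x, a & c] by rewrite /= xa rcons_path ac lc adj_sym.
have := tG.2 [:: x, a & c]; rewrite cyc => acyc; suff : false by [].
apply: acyc; first by rewrite cons_uniq xNc.
by case: c lc {ac uc csub xNc cyc} => //= ab; move: neq_ab; rewrite ab eqxx.
Qed.

Lemma upath_extend x a p y w : upath G x (a :: p) y -> adj G w x -> w != a ->
  upath G w (x :: a :: p) y.
Proof.
move=> xp wx wa; apply: upath_cons => //.
have [xa xN ap] := upath_behead xp.
apply/negP; rewrite inE => /orP[/eqP wxE|wp]; first by move: wx; rewrite wxE adj_irr.
have [p1 [p2 [ep xp1 _]]] := upath_prefix xp wp.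
have e : p1 = [:: w].
  apply: upath_uniq xp1 _; split => //=; first by rewrite adj_sym wx.
  by rewrite inE andbT; apply/eqP => xw; move: wx; rewrite xw adj_irr.
by move: ep; rewrite e => -[/esym]; move/eqP; rewrite (negbTE wa).
Qed.

(** The default value only matters for pairs which are not joined by a path. *)
Definition dist x y : nat := size (xget [::] [set p | upath G x p y]).

Lemma dist_upath x p y : upath G x p y -> dist x y = size p.
Proof.
move=> xp; rewrite /dist; case: xgetP => [p' -> /= xp'|/(_ p) //].
by rewrite (upath_uniq xp xp').
Qed.

Lemma distxx x : dist x x = 0%N.
Proof. by rewrite (@dist_upath x [::]). Qed.

Lemma dist_adj x y : adj G x y -> dist x y = 1%N.
Proof.
move=> xy; rewrite (@dist_upath x [:: y])//; split => //=; first by rewrite xy.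
by rewrite inE andbT; apply/eqP => e; move: xy; rewrite e adj_irr.
Qed.

(** One step from [x] moves towards [y] along the path to [y], and away from [y] along
    any other edge: this is the only way in which the tree structure enters the analysis
    of the adjacency operator. *)
Lemma dist_nbr x y : vert G x -> vert G y -> x != y ->
  exists a, [/\ adj G x a, dist x y = (dist a y).+1 &
    forall w, adj G x w -> w != a -> dist w y = (dist x y).+1].
Proof.
move=> Gx Gy xy; have [p xp] := upath_ex Gx Gy.
case: p xp => [|a p] xp; first by case: xp xy => _ _ /= ->; rewrite eqxx.
have [xa xN ap] := upath_behead xp.
exists a; split=> // [|w xw wa]; first by rewrite (dist_upath xp) (dist_upath ap).
by rewrite (dist_upath xp) (dist_upath (upath_extend xp _ wa)) // adj_sym.
Qed.

Lemma ballP x n y : vert G x -> ball G x n y <-> vert G y /\ (dist x y <= n)%N.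
Proof.
move=> Gx; split=> [[_ [p [xp <- sp]]]|[Gy xy]].
  split; first by apply: (path_vert Gx xp); exact: mem_last.
  case: (shortenP xp) => p' xp' up' sub.
  rewrite (@dist_upath x p')//; apply: leq_trans sp.
  by apply: uniq_leq_size => //; move: up' => /= /andP[].
have [p xp] := upath_ex Gx Gy.
split=> //; exists p; case: (xp) => ? ? ?; split => //.
by rewrite -(dist_upath xp).
Qed.

Lemma dist_triangle x y u : vert G x -> vert G y -> vert G u ->
  (dist x u <= dist x y + dist y u)%N.
Proof.
move=> Gx Gy Gu.
have [p xp] := upath_ex Gx Gy; have [p' yp'] := upath_ex Gy Gu.
have : ball G x (dist x y + dist y u) u.
  split=> //; exists (p ++ p'); case: xp yp' => xp up lp [yp' up' lp'].
  rewrite cat_path last_cat lp xp yp' lp'; split => //.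
  by rewrite (@dist_upath x p y) // (@dist_upath y p' u)// size_cat.
by move/(ballP _ _ Gx) => [].
Qed.

End Trees.

Section Sides.
Local Open Scope classical_set_scope.
Variables (G : sgraph) (tG : is_tree G).

Lemma adj_neq x y : adj G x y -> x != y.
Proof. by move=> xy; apply/eqP => e; move: xy; rewrite e adj_irr. Qed.

Lemma sideP x y z : adj G x y ->
  side G x y z <-> exists2 p, upath G x p z & y \notin p.
Proof.
move=> xy; split=> [xz|[p [xp up lp] yp]].
  have [p [xp up lp]] := upath_component xz.
  have xpG : path (adj G) x p.
    by apply: sub_path xp => u v /= /and3P[].
  exists p => //; apply/negP => yp.
  have pz : upath G x p z by split.
  have [p1 [p2 [ep xp1 _]]] := upath_prefix pz yp.
  have e : p1 = [:: y].
    apply: (upath_uniq tG) xp1 _; split => //=; first by rewrite xy.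
    by rewrite inE andbT adj_neq.
  by move: xp; rewrite ep e /= /del_adj /= !eqxx /= !andbF.
split; first exact: adj_vert xy.
exists p; split => //.
elim: p x xy xp up yp lp => //= a p IH x xy /andP[xa ap] /andP[xN up] yp lp.
have {}IH : path (adj (del_edges G [rel u v | (u == x) && (v == y)])) a p.
  move: xN yp; rewrite !inE !negb_or => /andP[xa' xp'] /andP[ya yp].
  elim: p a ap {up lp IH xa} xp' yp xa' ya => //= b p IH a /andP[ab bp].
  rewrite !inE !negb_or => /andP[xb xp] /andP[yb yp] xa ya.
  rewrite IH // /del_adj /= ab [a == x]eq_sym (negbTE xa).
  by rewrite [b == x]eq_sym (negbTE xb).
rewrite IH andbT /del_adj /= xa /=; move: yp; rewrite inE negb_or eq_sym => /andP[ay _].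
by rewrite (negbTE ay) [a == x]eq_sym (negbTE (adj_neq xa)) andbF.
Qed.

Lemma side_cover x y z : adj G x y -> vert G z -> side G x y z \/ side G y x z.
Proof.
move=> xy Gz; have [p xp] := upath_ex tG (adj_vert xy) Gz.
have [yp|yp] := boolP (y \in p); last by left; apply/sideP => //; exists p.
right; apply/sideP; first by rewrite adj_sym.
have [p1 [p2 [ep xp1 yp2]]] := upath_prefix xp yp.
have e : p1 = [:: y].
  apply: (upath_uniq tG) xp1 _; split => //=; first by rewrite xy.
  by rewrite inE andbT adj_neq.
exists p2 => //; move: xp; rewrite ep e => -[_ /= /andP[+ _] _].
by rewrite inE negb_or => /andP[].
Qed.

(** Walking on from [w] through [x] to [y] enlarges the side that is left behind, so the
    finite sides are oriented consistently. *)
Lemma side_sub x y w : adj G x y -> adj G x w -> w != y ->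
  side G w x `<=` side G x y.
Proof.
move=> xy xw wy z /sideP; rewrite adj_sym => /(_ xw)[p wp xp].
apply/sideP => //; exists (w :: p).
  apply: upath_cons => //; rewrite inE negb_or xp andbT; exact: adj_neq.
have : upath G x (w :: p) z.
  apply: upath_cons => //; rewrite inE negb_or xp andbT; exact: adj_neq.
move=> /(@upath_extend _ tG x w p z y).
rewrite adj_sym xy eq_sym wy => /(_ isT isT) [_ /= /andP[+ _] _].
by rewrite inE negb_or => /andP[].
Qed.

End Sides.

(** * Finite sides of edges, core vertices and the spine *)

Section Neighbours.
Local Open Scope classical_set_scope.
Local Open Scope card_scope.
Variables (d : nat) (G : sgraph) (dG : degree_le d G).

Definition nb (G : sgraph) (x : nat) : {fset nat} := fset_set [set y | adj G x y].

Lemma nb_finite x : finite_set [set y | adj G x y].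
Proof.
have [Gx|nGx] := pselect (vert G x); first exact: card_le_finite (dG Gx) (finite_II d).
suff -> : [set y | adj G x y] = set0 by exact: finite_set0.
by apply/seteqP; split=> // y /= /adj_vert.
Qed.

Lemma in_nb x y : (y \in nb G x) = adj G x y.
Proof.
rewrite /nb in_fset_set; last exact: nb_finite.
by apply/idP/idP => [/set_mem|?]; [|exact/mem_set].
Qed.

Lemma card_nb x : (#|` nb G x| <= d)%N.
Proof.
have [Gx|nGx] := pselect (vert G x); first exact/geq_card_fset_set/dG.
suff -> : nb G x = fset0%fset by [].
by apply/fsetP => y; rewrite in_nb inE; apply/negP => /adj_vert.
Qed.

Lemma ball0 x : ball G x 0 `<=` [set x].
Proof. by move=> y [_ [[|a p] [_ <- sp]]]. Qed.

Lemma ballS x n : ball G x n.+1 `<=`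
  [set x] `|` \bigcup_(w in [set w | adj G x w]) ball G w n.
Proof.
move=> y [Gx [[|w p] [/= xp <- sp]]]; [by left|right].
move: xp => /andP[xw wp]; exists w => //; split; first exact: adj_vertr xw.
by exists p.
Qed.

Lemma ball_finite x n : finite_set (ball G x n).
Proof.
elim: n x => [|n IH] x; first exact: sub_finite_set (@ball0 x) (finite_set1 x).
apply: sub_finite_set (@ballS x n) _; rewrite finite_setU; split=> //.
by apply: bigcup_finite => [|w _]; [exact: nb_finite|exact: IH].
Qed.

End Neighbours.

Section Core.
Local Open Scope classical_set_scope.
Variables (d : nat) (G : sgraph) (dG : degree_le d G) (tG : is_tree G).

(** A side is infinite when it contains arbitrarily long simple paths
    ([side_finiteP]); unlike infiniteness, this is a limit of conditions on balls, and
    [long_sideS] is a recursion over neighbours. *)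
Definition long_side (j x y : nat) : Prop :=
  exists p, [/\ path (adj G) x p, uniq (y :: x :: p) & size p = j].

Lemma long_sideS j x y : adj G x y ->
  long_side j.+1 x y <-> exists w, [/\ adj G x w, w != y & long_side j w x].
Proof.
move=> xy; split=> [[[|w p] [//]]|[w [xw wy [p [wp up sp]]]]].
  move=> /= /andP[xw wp] /and3P[yN xN up] [sp].
  exists w; split=> //; first by move: yN; rewrite !inE !negb_or [w == y]eq_sym => /and3P[].
  by exists p; split => //; rewrite cons_uniq xN.
exists (w :: p); split=> //=; [by rewrite xw | | by rewrite sp].
have xwp : upath G x (w :: p) (last w p) by split=> //=; rewrite xw.
have yx : adj G y x by rewrite adj_sym.
have yw : y != w by rewrite eq_sym.
by have [] := upath_extend tG xwp yx yw.
Qed.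

Lemma side_finiteP x y : adj G x y ->
  finite_set (side G x y) <-> exists j, ~ long_side j x y.
Proof.
move=> xy; split=> [/finite_setP[n sn]|[j Nj]].
  exists n => -[p [xp /= /andP[yN up] sp]].
  have sub : {subset x :: p <= fset_set (side G x y)}.
    move=> u uxp; rewrite in_fset_set; last by apply/finite_setP; exists n.
    apply/mem_set/sideP => //; move: uxp; rewrite inE => /orP[/eqP ->|up'].
      by exists [::].
    have [|p1 [p2 [ep xp1 _]]] := @upath_prefix G x p (last x p) u _ up'; first by split.
    exists p1 => //; move: yN; rewrite ep inE mem_cat.
    by apply: contra => ->; rewrite orbT.
  have := uniq_leq_size (up : uniq (x :: p)) sub.
  by rewrite (card_fset_set sn) /= sp ltnn.
apply: sub_finite_set (ball_finite dG x j) => z /(sideP tG _ xy)[p xp yp].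
split; first exact: adj_vert xy.
exists p; case: (xp) => ? ? ?; split => //.
rewrite leqNgt; apply/negP => jp; apply: Nj.
case: xp => xp up _.
exists (take j p); split; first by rewrite take_path.
  rewrite cons_uniq inE negb_or [y == x]eq_sym (adj_neq xy) /=.
  have sub : subseq (x :: take j p) (x :: p) by rewrite /= eqxx take_subseq.
  move: (subseq_uniq sub up) => /= ->; rewrite andbT.
  by apply: contra yp; apply: mem_take.
by rewrite size_take jp.
Qed.

(** In an infinite tree these are the vertices of the spine ([spine_core],
    [core_spine]); this description only involves the edges at [x]. *)
Definition in_core (x : nat) : Prop :=
  vert G x /\ forall y, adj G x y -> infinite_set (side G x y).

Lemma vert_sides x y : adj G x y -> vert G `<=` side G x y `|` side G y x.
Proof. by move=> xy z Gz; have [] := side_cover tG xy Gz; [left|right]. Qed.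

Section Infinite.
Hypothesis iG : infinite_set (vert G).

Lemma finite_side_asym x y : adj G x y ->
  finite_set (side G x y) -> infinite_set (side G y x).
Proof.
move=> xy fxy fyx; apply: iG; apply: sub_finite_set (vert_sides xy) _.
by rewrite finite_setU.
Qed.

Lemma finite_side_dir x : vert G x -> ~ in_core x ->
  exists a, [/\ adj G x a, finite_set (side G x a) &
    forall w, adj G x w -> w != a -> finite_set (side G w x)].
Proof.
move=> Gx nx; have [a [xa fa]] : exists a, adj G x a /\ finite_set (side G x a).
  apply: contrapT => H; apply: nx; split=> // y xy fy; apply: H; by exists y.
exists a; split=> // w xw wa; apply: sub_finite_set fa; exact: side_sub.
Qed.

(** The side left behind is infinite at the first step because the path starts in the
    core, and it only grows afterwards. *)
Lemma core_path x p y : in_core x -> upath G x p y ->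
  path (fun u v => adj G u v && `[< infinite_set (side G u v) >]) x p.
Proof.
move=> [_ cx]; case: p => [//|a p] xp.
have [xa _ _] := upath_behead xp.
have ia : infinite_set (side G x a) by exact: cx.
rewrite /= xa asboolT //=.
case: xp => /= /andP[_ ap] /andP[xN ua] _.
elim: p x a {cx} xa ia ap xN ua => // b p IH x a xa ia /= /andP[ab bp] xN /andP[aN ub].
have ib : infinite_set (side G a b).
  move=> fb; apply: ia; apply: sub_finite_set fb; apply: side_sub => //.
    by rewrite adj_sym.
  by move: xN; rewrite !inE !negb_or => /and3P[].
by rewrite ab asboolT //= (IH a b).
Qed.

Local Notation strong := (del_edges G (weak_edge G)).

Lemma strongP u v : adj G u v -> infinite_set (side G u v) ->
  infinite_set (side G v u) -> adj strong u v.
Proof.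
move=> uv iu iv; have vu : adj G v u by rewrite adj_sym.
rewrite /= /del_adj /= uv /weak_edge /= uv vu /=.
by apply/andP; split; apply/negP => /asboolP[].
Qed.

Lemma strong_adj u v : adj strong u v ->
  [/\ adj G u v, infinite_set (side G u v) & infinite_set (side G v u)].
Proof.
rewrite /= /del_adj /= => /and3P[uv + _]; rewrite /weak_edge /= uv /= => /asboolPn H.
by split=> // f; apply: H; [left|right].
Qed.

(** Apply [core_path] to the path and to its reverse. *)
Lemma core_strong_path x p y : in_core x -> in_core y -> upath G x p y ->
  path (adj strong) x p.
Proof.
move=> cx cy xp.
have f1 := core_path cx xp.
have := core_path cy (upath_rev xp).
have lp : last x p = y by case: xp.
rewrite -{1}lp rev_path => f2.
elim: p x {cx xp lp} f1 f2 => //= a p IH x /andP[/andP[xa /asboolP ia] f1].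
move=> /andP[/andP[_ /asboolP ix] f2].
by rewrite IH // andbT; exact: strongP.
Qed.

Lemma strong_core x v : in_core x -> adj strong x v -> in_core v.
Proof.
move=> [Gx cx] /strong_adj[xv ix iv]; split; first exact: adj_vertr xv.
move=> y vy; have [->//|yx] := eqVneq y x.
move=> fy; apply: ix; apply: sub_finite_set fy.
by apply: side_sub => //; [rewrite adj_sym|rewrite eq_sym].
Qed.

Lemma component_core x z : in_core x -> component strong x z -> in_core z.
Proof.
move=> cx [_ [p [xp <-]]]; elim: p x cx xp => //= a p IH x cx /andP[xa ap].
by apply: IH ap; exact: strong_core xa.
Qed.

Lemma component_step x y z : component strong x y -> adj strong y z ->
  component strong x z.
Proof.
move=> [Gx [p [xp lp]]] yz; split=> //; exists (rcons p z).
by rewrite rcons_path xp lp yz last_rcons.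
Qed.

(** Otherwise the tree would be the union of that component and of the finitely
    many finite sides that are cut off from it. *)
Lemma core_component_infinite x : in_core x -> infinite_set (component strong x).
Proof.
move=> cx fC; set C := component strong x in fC; apply: iG.
pose F v := \bigcup_(z in [set z | adj G v z /\ finite_set (side G z v)]) side G z v.
suff sub : vert G `<=` C `|` \bigcup_(v in C) F v.
  apply: sub_finite_set sub _; rewrite finite_setU; split=> //.
  apply: bigcup_finite => // v _; apply: bigcup_finite => [|z []//].
  by apply: sub_finite_set (nb_finite dG v) => z [].
move=> t Gt; have [p xp] := upath_ex tG (cx.1) Gt.
have : C x by split; [exact: cx.1|exists [::]].
move: xp; move: {1 2}x => u; elim: p u => [|z p IH] u up Cu.
  by case: up Cu => _ _ /= ->; left.
have [uz uN zp] := upath_behead up.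
have [fz|iz] := pselect (finite_set (side G z u)).
  right; exists u => //; exists z => //; apply/sideP; rewrite 1?adj_sym //.
  by exists p => //; move: uN; rewrite inE negb_or => /andP[].
apply: IH zp _; apply: (component_step Cu); apply: strongP => //.
by have [_] := component_core cx Cu; apply.
Qed.

(** A component of the graph without weak edges cannot leave a finite side. *)
Lemma spine_core x : vert (spine G) x -> in_core x.
Proof.
move=> [/= Gx ix]; split=> // y xy fy; apply: ix; apply: (sub_finite_set _ fy).
move=> z [_ [p [xp <-]]]; split=> //; exists p; split=> //.
apply: sub_path xp => u v uv; have [Guv iu iv] := strong_adj uv.
rewrite /= /del_adj /= Guv /=; apply/andP; split; apply/negP => /andP[/eqP ex /eqP ey].
- by apply: iu; rewrite ex ey.
- by apply: iv; rewrite ex ey.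
Qed.

Lemma core_spine x : in_core x -> vert (spine G) x.
Proof. by move=> cx; split; [exact: cx.1|exact: core_component_infinite]. Qed.

Lemma core_spine_ball x y n : in_core x -> in_core y -> (dist G x y <= n)%N ->
  ball (spine G) x n y.
Proof.
move=> cx cy xyn; split; first exact: core_spine.
have [p xp] := upath_ex tG cx.1 cy.1.
have sp := core_strong_path cx cy xp.
exists p; case: (xp) => _ _ lp; split=> //; last by rewrite -(dist_upath tG xp).
elim: p x sp cx {xyn xp lp} => //= a p IH x /andP[xa ap] cx.
have ca := strong_core cx xa.
rewrite IH // andbT /induced_adj /=; apply/and3P; split=> //.
- by apply/mem_set; have [] := core_spine cx.
- by apply/mem_set; have [] := core_spine ca.
Qed.

Lemma spine_ball_sub x n : ball (spine G) x n `<=` ball G x n.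
Proof.
move=> y [[Gx _] [p [xp lp sp]]]; split=> //; exists p; split=> //.
by apply: sub_path xp => u v; rewrite /= /induced_adj /= => /and3P[/strong_adj[]].
Qed.

End Infinite.
End Core.

(** * Local functionals and their pointwise limits *)

Section Covers.
Local Open Scope classical_set_scope.

Definition linked (G : sgraph) (x y : nat) : Prop :=
  vert G x /\ (y = x \/ adj G x y).

(** [f] is a covering map near [x]: it maps neighbours bijectively to neighbours at every
    vertex within distance less than [r] of [x]. Sums over neighbours only depend on such
    data, and the condition passes to neighbours without recentering balls. *)
Fixpoint covers (r : nat) (G H : sgraph) (f : nat -> nat) (x : nat) : Prop :=
  if r is r'.+1 then
    [/\ {in nb G x &, injective f}, nb H (f x) = [fset f y | y in nb G x]%fset &
        forall w, w \in nb G x -> covers r' G H f w]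
  else True.

Lemma covers_le r r' G H f x : (r <= r')%N -> covers r' G H f x -> covers r G H f x.
Proof.
elim: r r' x => [|r IH] [|r'] x //= rr' [fi fn fc]; split=> // w xw.
by apply: (IH r') => //; exact: fc.
Qed.

Section PartialIso.
Variables (d : nat) (G H : cgraph d) (o R : nat) (f : nat -> nat).
Hypothesis fb : set_bij (vert (induced G (ball G o R)))
  (vert (induced H (ball H (f o) R))) f.
Hypothesis fa : forall x y, vert (induced G (ball G o R)) x ->
  vert (induced G (ball G o R)) y ->
  adj (induced H (ball H (f o) R)) (f x) (f y) = adj (induced G (ball G o R)) x y.

Lemma ball_le (K : sgraph) x m n : (m <= n)%N -> ball K x m `<=` ball K x n.
Proof.
by move=> mn y [Kx [p [? ? pm]]]; split=> //; exists p; split=> //; exact: leq_trans mn.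
Qed.

Lemma ball_self (K : sgraph) x n : vert K x -> ball K x n x.
Proof. by move=> Kx; split=> //; exists [::]. Qed.

Lemma ball_vert (K : sgraph) x n : ball K x n `<=` vert K.
Proof.
by move=> y [Kx [p [xp <- _]]]; apply: (path_vert Kx xp); exact: mem_last.
Qed.

Lemma ball_adj (K : sgraph) o' n x y : ball K o' n x -> adj K x y -> ball K o' n.+1 y.
Proof.
move=> [Ko [p [op lp pn]]] xy; split=> //; exists (rcons p y).
by rewrite rcons_path op lp xy last_rcons size_rcons.
Qed.

Lemma partial_iso_adj x y : ball G o R x -> ball G o R y ->
  adj H (f x) (f y) = adj G x y.
Proof.
move=> Bx By; have [fGH _ _] := fb.
have vx : vert (induced G (ball G o R)) x by split=> //; exact: ball_vert Bx.
have vy : vert (induced G (ball G o R)) y by split=> //; exact: ball_vert By.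
have := fa vx vy; have [_ Bfx] := fGH _ vx; have [_ Bfy] := fGH _ vy.
by rewrite /= /induced_adj /= !mem_set // !andbT.
Qed.

Lemma partial_iso_ball n x : (n <= R)%N -> ball G o n x -> ball H (f o) n (f x).
Proof.
move=> nR [Go [p [op <- pn]]]; split.
  have [fGH _ _] := fb; have [] // := fGH o.
  by split=> //; exact: ball_self.
exists (map f p); rewrite last_map size_map; split=> //.
have : ball G o 0 o by exact: ball_self.
have : (0 + size p <= R)%N by apply: leq_trans nR.
move: op; move: {1 3 4}o {1 2}0%N => u k; elim: p u k {pn} => //= a p IH u k.
move=> /andP[ua ap] kR Bu; have Ba := ball_adj Bu ua.
rewrite partial_iso_adj ?ua /=; first by apply: (IH a k.+1) => //; lia.
- by apply: ball_le Bu; lia.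
- by apply: ball_le Ba; lia.
Qed.

Lemma partial_iso_covers r n x : (n + r <= R)%N -> ball G o n x -> covers r G H f x.
Proof.
have [fGH fi fs] := fb.
have Bv u : ball G o R u -> vert (induced G (ball G o R)) u.
  by move=> Bu; split=> //; exact: ball_vert Bu.
elim: r n x => [//|r IH] n x nr Bx /=.
have dG := @cgraph_degree _ G; have dH := @cgraph_degree _ H.
have Bx' : ball G o R x by apply: ball_le Bx; lia.
have Bw w : adj G x w -> ball G o R w.
  by move=> xw; apply: ball_le (ball_adj Bx xw); lia.
split.
- move=> u v; rewrite !(in_nb dG) => xu xv; apply: fi; apply/mem_set/Bv/Bw => //.
- apply/fsetP => h; rewrite (in_nb dH); apply/idP/imfsetP => /=.
    move=> xh; have Bfx : ball H (f o) n (f x) by apply: partial_iso_ball => //; lia.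
    have Bh : ball H (f o) R h by apply: ball_le (ball_adj Bfx xh); lia.
    have [] := fs h; first by split=> //; exact: ball_vert Bh.
    move=> w [Gw Bw'] fw; exists w => //; rewrite (in_nb dG).
    by rewrite -partial_iso_adj ?fw.
  move=> [w]; rewrite (in_nb dG) => xw ->; rewrite partial_iso_adj //; exact: Bw.
- move=> w; rewrite (in_nb dG) => xw; apply: (IH n.+1); first by lia.
  exact: ball_adj Bx xw.
Qed.

End PartialIso.

Lemma iso_covers d (G H : cgraph d) f r x :
  set_bij (vert G) (vert H) f ->
  (forall x y, vert G x -> vert G y -> adj H (f x) (f y) = adj G x y) ->
  vert G x -> covers r G H f x.
Proof.
move=> [fGH fi fs] fa; elim: r x => [//|r IH] x Gx /=.
have dG := @cgraph_degree _ G; have dH := @cgraph_degree _ H.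
split.
- move=> u v; rewrite !(in_nb dG) => xu xv; apply: fi; apply/mem_set.
    exact: adj_vertr xu.
  exact: adj_vertr xv.
- apply/fsetP => h; rewrite (in_nb dH); apply/idP/imfsetP => /=.
    move=> xh; have [w Gw fw] := fs h (adj_vertr xh).
    by exists w => //; rewrite (in_nb dG) -fa ?fw.
  move=> [w]; rewrite (in_nb dG) => xw ->; rewrite fa //; exact: adj_vertr xw.
- by move=> w; rewrite (in_nb dG) => xw; apply: IH; exact: adj_vertr xw.
Qed.

End Covers.

Section Baire.
Local Open Scope classical_set_scope.
Variables (R : realType) (d : nat).

Definition fnl := cgraph d -> nat -> nat -> R.

Definition local_fnl (r : nat) (F : fnl) := forall (G H : cgraph d) f x y,
  linked G x y -> linked H (f x) (f y) -> covers r G H f x -> F G x y = F H (f x) (f y).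

(** The functionals obtained from local ones by iterated limits. Measurability does not
    directly survive a sum over the neighbours of a vertex, since there is no measurable
    choice of a neighbour; locality and pointwise limits do ([baire_nsum]). *)
Inductive baire : fnl -> Prop :=
| baire_local r F of local_fnl r F : baire F
| baire_lim (Fn : nat -> fnl) F of (forall n, baire (Fn n)) &
    (forall (G : cgraph d) x y, linked G x y -> Fn n G x y @[n --> \oo] --> F G x y) : baire F.

Lemma baire_ext F F' : baire F -> (forall (G : cgraph d) x y, linked G x y -> F G x y = F' G x y) ->
  baire F'.
Proof.
move=> bF e; apply: (@baire_lim (fun=> F)) => // G x y xy.
rewrite e //; exact: cvg_cst.
Qed.

Lemma baire_covers F : baire F -> forall (G H : cgraph d) f x y, linked G x y ->
  linked H (f x) (f y) -> (forall r, covers r G H f x) -> F G x y = F H (f x) (f y).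
Proof.
elim=> {F} [r F lF|Fn F _ IH Flim] G H f x y xy fxy cov; first exact: lF.
have A := Flim _ _ _ xy; have B := Flim _ _ _ fxy.
have e : (fun n => Fn n H (f x) (f y)) = (fun n => Fn n G x y).
  by apply/funext => n; rewrite (IH n G H f x y).
by rewrite e in B; apply: cvg_unique A B; exact: Rhausdorff.
Qed.

Lemma baire_cst c : baire (fun _ _ _ => c).
Proof. by apply: (@baire_local 0). Qed.

Lemma baire_op2 (phi : R -> R -> R) F F' : (forall a, continuous (phi a)) ->
  (forall b, continuous (phi^~ b)) -> baire F -> baire F' ->
  baire (fun G x y => phi (F G x y) (F' G x y)).
Proof.
move=> c1 c2 bF; elim: bF F' => {F} [r F lF|Fn F _ IH Flim] F' bF'.
  elim: bF' => {F'} [r' F' lF'|Fn F' _ IH Flim].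
    apply: (@baire_local (maxn r r')) => G H f x y xy fxy cov.
    rewrite (lF G H f) // ?(lF' G H f) //; apply: covers_le cov.
      exact: leq_maxr.
    exact: leq_maxl.
  apply: (baire_lim IH) => G x y xy /=.
  by apply: continuous_cvg; [exact: c1|exact: Flim].
apply: (@baire_lim (fun n G x y => phi (Fn n G x y) (F' G x y))) => [n|G x y xy].
  exact: IH.
by apply: (@continuous_cvg _ _ _ _ _ _ (phi^~ (F' G x y))); [exact: c2|exact: Flim].
Qed.

Definition nsum (F : fnl) : fnl := fun G x _ => \sum_(w <- nb G x) F G x w.
Definition swap (F : fnl) : fnl := fun G x y => F G y x.

Lemma linked_nb (G : cgraph d) x w : w \in nb G x -> linked G x w.
Proof.
rewrite (in_nb (@cgraph_degree _ G)) => xw; split; [exact: adj_vert xw|by right].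
Qed.

Lemma linked_sym (G : cgraph d) x y : linked G x y -> linked G y x.
Proof.
move=> [Gx [-> //|xy]]; first by split=> //; left.
by split; [exact: adj_vertr xy|right; rewrite adj_sym].
Qed.

Lemma baire_nsum F : baire F -> baire (nsum F).
Proof.
elim=> {F} [r F lF|Fn F _ IH Flim].
  apply: (@baire_local r.+1) => G H f x y xy fxy [fi fn fc].
  rewrite /nsum fn big_imfset //=; apply: eq_big_seq => w xw.
  apply: lF; first exact: linked_nb.
    by apply: linked_nb; rewrite fn; apply/imfsetP; exists w.
  by apply: covers_le (leqnSn r) _; split.
apply: (@baire_lim (fun n => nsum (Fn n))) => [//|G x y xy].
rewrite /nsum.
rewrite (_ : (fun n => \sum_(w <- nb G x) Fn n G x w) =
   (fun n => \sum_(w <- nb G x | w \in nb G x) Fn n G x w)); last first.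
  apply/funext => n; rewrite [RHS]big_seq_cond; under [RHS]eq_bigl do rewrite andbb.
  by rewrite big_seq.
rewrite big_seq; apply: cvg_big => [|w xw]; last by apply: Flim; exact: linked_nb.
exact: add_continuous.
Qed.

Lemma baire_swap F : baire F -> baire (swap F).
Proof.
elim=> {F} [r F lF|Fn F _ IH Flim]; last first.
  apply: (baire_lim IH) => G x y xy; apply: Flim; exact: linked_sym.
apply: (@baire_local r.+1) => G H f x y xy fxy cov.
apply: lF; [exact: linked_sym|exact: linked_sym|].
have [_ [->|xy']] := xy; first by apply: covers_le cov.
by case: cov => _ _; apply; rewrite (in_nb (@cgraph_degree _ G)).
Qed.

End Baire.

(** * Nonnegative bounded functionals *)

Section Nice.
Local Open Scope classical_set_scope.
Variables (R : realType) (d : nat).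
Implicit Types F : fnl R d.

(** Nonnegativity and boundedness make all integrals finite and additive. *)
Definition nice F := baire F /\
  exists M, forall (G : cgraph d) x y, linked G x y -> 0 <= F G x y <= M.

Lemma nice_ge0 F (G : cgraph d) x y : nice F -> linked G x y -> 0 <= F G x y.
Proof. by move=> [_ [M FM]] /FM/andP[]. Qed.

Lemma nice_ext F F' : nice F ->
  (forall (G : cgraph d) x y, linked G x y -> F G x y = F' G x y) -> nice F'.
Proof.
move=> [bF [M FM]] e; split; first exact: baire_ext bF e.
by exists M => G x y xy; rewrite -e //; exact: FM.
Qed.

Lemma nice_cst c : 0 <= c -> nice (fun _ _ _ => c).
Proof. by move=> c0; split; [exact: baire_cst|exists c => *; rewrite c0 /=]. Qed.

Lemma nice_add F F' : nice F -> nice F' -> nice (fun G x y => F G x y + F' G x y).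
Proof.
move=> [bF [M FM]] [bF' [M' FM']]; split.
  apply: (baire_op2 (phi := fun a b => a + b)) => // [a b|b a].
    by apply: continuousD; [exact: cst_continuous|exact: id].
  by apply: continuousD; [exact: id|exact: cst_continuous].
exists (M + M') => G x y xy; have /andP[a b] := FM _ _ _ xy.
by have /andP[a' b'] := FM' _ _ _ xy; rewrite addr_ge0 //= lerD.
Qed.

Lemma nice_mul F F' : nice F -> nice F' -> nice (fun G x y => F G x y * F' G x y).
Proof.
move=> [bF [M FM]] [bF' [M' FM']]; split.
  apply: (baire_op2 (phi := fun a b => a * b)) => // [a b|b a].
    exact: mulrl_continuous.
  exact: mulrr_continuous.
exists (M * M') => G x y xy; have /andP[a b] := FM _ _ _ xy.
by have /andP[a' b'] := FM' _ _ _ xy; rewrite mulr_ge0 //= ler_pM.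
Qed.

Lemma nice_min F F' : nice F -> nice F' -> nice (fun G x y => Num.min (F G x y) (F' G x y)).
Proof.
move=> [bF [M FM]] [bF' [M' FM']]; split.
  apply: (baire_op2 (phi := fun a b => Num.min a b)) => // [a b|b a].
    by apply: (@continuous_min R R (fun=> a) id); [exact: cst_continuous|exact: id].
  by apply: (@continuous_min R R id (fun=> b)); [exact: id|exact: cst_continuous].
exists M => G x y xy; have /andP[a b] := FM _ _ _ xy.
by have /andP[a' b'] := FM' _ _ _ xy; rewrite le_min a a' ge_min b.
Qed.

Definition clamp (t : R) : R := Num.min 1 (Num.max 0 t).

Lemma clamp_ge0 t : 0 <= clamp t.
Proof. by rewrite /clamp le_min ler01 le_max lexx. Qed.

Lemma clamp_le1 t : clamp t <= 1.
Proof. by rewrite /clamp ge_min lexx. Qed.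

Lemma clamp0 t : t <= 0 -> clamp t = 0.
Proof. by rewrite /clamp => t0; rewrite max_l // min_r. Qed.

Lemma clamp1 t : 1 <= t -> clamp t = 1.
Proof. by rewrite /clamp => t1; rewrite min_l // le_max t1 orbT. Qed.

Lemma nice_clampB F F' : nice F -> nice F' ->
  nice (fun G x y => clamp (F G x y - F' G x y)).
Proof.
move=> [bF _] [bF' _]; split; last first.
  by exists 1 => G x y _; rewrite clamp_ge0 clamp_le1.
have cc : continuous clamp.
  move=> t; apply: (@continuous_min R R (fun=> 1) (fun t => Num.max 0 t)).
    exact: cst_continuous.
  by apply: (@continuous_max R R (fun=> 0) id); [exact: cst_continuous|exact: id].
apply: (baire_op2 (phi := fun a b => clamp (a - b))) => // [a b|b a].
  apply: (@continuous_comp _ _ _ (fun b => a - b) clamp); last exact: cc.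
  by apply: continuousB; [exact: cst_continuous|exact: id].
apply: (@continuous_comp _ _ _ (fun a => a - b) clamp); last exact: cc.
by apply: continuousB; [exact: id|exact: cst_continuous].
Qed.

Lemma nice_inv1D F : nice F -> nice (fun G x y => (1 + F G x y)^-1).
Proof.
move=> nF; have [bF [M FM]] := nF; split; last first.
  exists 1 => G x y xy; have F0 := nice_ge0 nF xy.
  by rewrite invr_ge0 addr_ge0 //= invf_le1 ?ltr_pwDl // lerDl.
have : baire (fun G x y => (1 + `|F G x y|)^-1 : R).
  apply: (baire_op2 (phi := fun a b => (1 + `|a|)^-1) (F' := F)) => // [a|b a].
    exact: cst_continuous.
  apply: (@continuousV _ _ (fun a => 1 + `|a|)).
    by rewrite gt_eqF // ltr_pwDl.
  by apply: continuousD; [exact: cst_continuous|exact: norm_continuous].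
by move/baire_ext; apply => G x y xy; rewrite ger0_norm // (nice_ge0 nF xy).
Qed.

Lemma nice_nsum F : nice F -> nice (nsum F).
Proof.
move=> nF; have [bF [M FM]] := nF; split; first exact: baire_nsum.
exists (d%:R * `|M|) => G x y xy; apply/andP; split.
  by rewrite /nsum big_seq sumr_ge0 // => w xw; apply: (nice_ge0 nF); exact: linked_nb.
apply: (@le_trans _ _ (\sum_(w <- nb G x) `|M|)).
  rewrite /nsum big_seq [leRHS]big_seq; apply: ler_sum => w xw.
  by have /andP[_ /le_trans] := FM _ _ _ (linked_nb xw); apply; exact: ler_norm.
rewrite big_const_seq count_predT iter_addr_0 -[leLHS]mulr_natl.
apply: ler_wpM2r; rewrite // ler_nat.
exact: card_nb (@cgraph_degree _ G) x.
Qed.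

Lemma nice_swap F : nice F -> nice (swap F).
Proof.
move=> [bF [M FM]]; split; first exact: baire_swap.
by exists M => G x y xy; apply: FM; exact: linked_sym.
Qed.

Lemma nice_sum (I : Type) (r : seq I) (Fi : I -> fnl R d) :
  (forall i, nice (Fi i)) -> nice (fun G x y => \sum_(i <- r) Fi i G x y).
Proof.
move=> nFi; elim: r => [|i r IH].
  by apply: nice_ext (nice_cst (lexx 0)) _ => G x y _; rewrite big_nil.
by apply: nice_ext (nice_add (nFi i) IH) _ => G x y _; rewrite big_cons.
Qed.

Definition finf (Fn : nat -> fnl R d) : fnl R d :=
  fun G x y => inf (range (fun n => Fn n G x y)).

(** The running minima are obtained by finitely many operations, and decrease to the
    infimum. *)
Lemma nice_finf (Fn : nat -> fnl R d) : (forall n, nice (Fn n)) -> nice (finf Fn).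
Proof.
move=> nFn.
pose m := fix m n : fnl R d := if n is n'.+1 then
  fun G x y => Num.min (m n' G x y) (Fn n'.+1 G x y) else Fn 0%N.
have nm n : nice (m n) by elim: n => [|n IH]; [exact: nFn|exact: nice_min].
have lb (G : cgraph d) x y : linked G x y -> lbound (range (fun n => Fn n G x y)) 0.
  by move=> xy _ [n _ <-]; exact: nice_ge0.
have minf (G : cgraph d) x y : linked G x y -> m n G x y @[n --> \oo] --> finf Fn G x y.
  move=> xy.
  have -> : finf Fn G x y = inf (range (fun n => m n G x y)).
    have hF : has_inf (range (fun n => Fn n G x y)).
      by split; [exists (Fn 0%N G x y); exists 0%N|exists 0; exact: lb].
    have hm : has_inf (range (fun n => m n G x y)).
      split; [by exists (m 0%N G x y); exists 0%N|exists 0 => _ [n _ <-]].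
      exact: nice_ge0 (nm n) xy.
    apply/eqP; rewrite eq_le; apply/andP; split.
      apply: lb_le_inf => [|_ [n _ <-]]; first by case: hm.
      elim: n => [|n IH] /=; first by apply: ge_inf; [case: hF|exists 0%N].
      by rewrite le_min IH; apply: ge_inf; [case: hF|exists n.+1].
    apply: lb_le_inf => [|_ [n _ <-]]; first by case: hF.
    apply: (@le_trans _ _ (m n G x y)); first by apply: ge_inf; [case: hm|exists n].
    by case: n => [//|n] /=; rewrite ge_min lexx orbT.
  apply: nonincreasing_cvgn; last by exists 0 => _ [n _ <-]; exact: nice_ge0 (nm n) xy.
  by apply/nonincreasing_seqP => n /=; rewrite ge_min lexx.
split; first by apply: (baire_lim (fun n => (nm n).1)).
have [M FM] := (nFn 0%N).2; exists M => G x y xy; apply/andP; split.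
  apply: lb_le_inf; last exact: lb.
  by exists (Fn 0%N G x y); exists 0%N.
apply: le_trans (_ : Fn 0%N G x y <= M); last by case/andP: (FM _ _ _ xy).
by apply: ge_inf; [exists 0; exact: lb|exists 0%N].
Qed.

End Nice.

(** * Measurability and mass transport along edges *)

Section Measurability.
Local Open Scope classical_set_scope.
Local Open Scope quotient_scope.
Variables (R : realType) (d : nat).

Section Cylinders.
Variable k : nat.

Lemma cylinder_open (i : marked_class d k * nat) : open (cylinder i : set (marked_class d k)).
Proof.
exists [set cylinder i]; last by rewrite bigcup_set1.
move=> A ->; exists (fset1 i); last by rewrite set_fset1 bigcap_set1.
by move=> ?; rewrite !inE.
Qed.

(** Every preimage is a union of cylinders, hence open. *)
Lemma measurable_locally_constant (g : marked_class d k -> R) :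
  (forall c, exists r, agree r (repr c) (repr c) /\
    forall c', agree r (repr c) (repr c') -> g c' = g c) ->
  measurable_fun setT (g : borel_class d k -> R).
Proof.
move=> lg _ Y _; rewrite setTI; apply: sub_sigma_algebra.
suff -> : g @^-1` Y = \bigcup_(i in [set i | cylinder i `<=` g @^-1` Y])
    (cylinder i : set (marked_class d k)).
  by apply: bigcup_open => i _; exact: cylinder_open.
apply/seteqP; split=> [c Yc|c [i /= + ci]]; last by apply.
have [r [cc cr]] := lg c; exists (c, r) => // c' /cr /= e.
by rewrite e.
Qed.

End Cylinders.

Lemma agree_refl k (m : marked_graph d k) r :
  (forall x, x \in mark_seq m -> ball m (val (root m)) r x) -> agree r m m.
Proof.
move=> mr; split=> //; exists id; split=> //; last by rewrite map_id.
by split=> // x vx; exists x.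
Qed.

Lemma root_vert k (m : marked_graph d k) : vert m (val (root m)).
Proof. exact: set_valP. Qed.

Lemma mark_seq1 (m : marked_graph d 0) : mark_seq m = [:: val (root m)].
Proof.
by rewrite /mark_seq /root; case: (marks m) => -[|a [|b s]].
Qed.

Lemma mark_seq2 (m : marked_graph d 1) :
  mark_seq m = [:: val (root m); val (tnth (marks m) ord_max)].
Proof.
rewrite /mark_seq /root; case: (marks m) => -[|a [|b [|c s]]] //=.
Qed.

Definition rval (F : fnl R d) (c : marked_class d 0) : R :=
  F (repr c) (val (root (repr c))) (val (root (repr c))).

(** The value [0] off the edges confines the mass transport to edges. *)
Definition bival (F : fnl R d) (c : marked_class d 1) : R :=
  let m := repr c in let x := val (root m) in let y := val (tnth (marks m) ord_max) in
  if adj m x y then F m x y else 0.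

Lemma agreeP k r (G H : marked_graph d k) : agree r G H ->
  exists f, [/\ set_bij (vert (induced G (ball G (val (root G)) r)))
      (vert (induced H (ball H (f (val (root G))) r))) f,
    forall x y, vert (induced G (ball G (val (root G)) r)) x ->
      vert (induced G (ball G (val (root G)) r)) y ->
      adj (induced H (ball H (f (val (root G))) r)) (f x) (f y) =
      adj (induced G (ball G (val (root G)) r)) x y,
    map f (mark_seq G) = mark_seq H & f (val (root G)) = val (root H)].
Proof.
move=> [mG mH [f [fb fa fm]]]; exists f.
suff e : f (val (root G)) = val (root H) by rewrite e.
move: fm; rewrite /mark_seq /root.
case: (marks G) => -[//|a s] /= i; case: (marks H) => -[//|b t] /= j [+ _].
by rewrite /thead !(tnth_nth a) (tnth_nth b).
Qed.

Lemma linked_root k (m : marked_graph d k) : linked m (val (root m)) (val (root m)).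
Proof. by split; [exact: root_vert|left]. Qed.

Lemma measurable_rval F : baire F -> measurable_fun setT (rval F : rooted_class d -> R).
Proof.
elim=> {F} [r F lF|Fn F _ IH Flim].
  apply: measurable_locally_constant => c; exists r; split.
    apply: agree_refl => x; rewrite mark_seq1 inE => /eqP ->.
    by apply: ball_self; exact: root_vert.
  move=> c' /agreeP[f [fb fa fm fr]]; rewrite /rval -fr.
  apply/esym/lF; first exact: linked_root.
    by rewrite fr; exact: linked_root.
  by apply: (partial_iso_covers fb fa (n := 0)) => //; apply: ball_self; exact: root_vert.
apply: (measurable_fun_cvg IH) => c _; apply: Flim; exact: linked_root.
Qed.

Lemma measurable_bival F : baire F -> measurable_fun setT (bival F : birooted_class d -> R).
Proof.
elim=> {F} [r F lF|Fn F _ IH Flim]; last first.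
  apply: (measurable_fun_cvg IH) => c _; rewrite /bival.
  case: ifP => xy; last exact: cvg_cst.
  by apply: Flim; split; [exact: root_vert|right].
apply: measurable_locally_constant => c.
set m := repr c; set x := val (root m); set y := val (tnth (marks m) ord_max).
have [_ [p [xp lp]]] : component m x y.
  by apply: cgraph_connected; [exact: root_vert|exact: set_valP].
have Bm : forall u, u \in mark_seq m -> ball m x (size p + r).+1 u.
  move=> u; rewrite mark_seq2 !inE => /orP[] /eqP ->.
    by apply: ball_self; exact: root_vert.
  by split; [exact: root_vert|exists p; split=> //; lia].
exists (size p + r).+1; split; first exact: agree_refl.
move=> c' /agreeP[f [fb fa fm fr]]; rewrite /bival -/m -/x -/y.
have [fx fy] : f x = val (root (repr c')) /\ f y = val (tnth (marks (repr c')) ord_max).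
  by move: fm; rewrite !mark_seq2 => -[].
rewrite -fx -fy (partial_iso_adj fb fa); last 2 first.
- by apply: Bm; rewrite mark_seq2 inE eqxx.
- by apply: Bm; rewrite mark_seq2 !inE eqxx orbT.
case: ifP => // xy; apply/esym/lF.
- by split; [exact: root_vert|right].
- rewrite fx; split; first exact: root_vert.
  right; rewrite -fx (partial_iso_adj fb fa) //.
    by apply: Bm; rewrite mark_seq2 inE eqxx.
  by apply: Bm; rewrite mark_seq2 !inE eqxx orbT.
- apply: (partial_iso_covers fb fa (n := 0)); first by lia.
  by apply: ball_self; exact: root_vert.
Qed.

Lemma bival_birooted F (G : cgraph d) (x y : set_type (vert G)) : baire F ->
  bival F (birooted x y) = if adj G (val x) (val y) then F G (val x) (val y) else 0.
Proof.
move=> bF; rewrite /birooted; set m := MarkedGraph _.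
have /asboolP[f [fb fa]] : isomorphic m (repr (\pi_(marked_class d 1) m)).
  by have /eqquotP := esym (reprK (\pi_(marked_class d 1) m)).
set m' := repr _ in fb fa *; rewrite !mark_seq2 => fm.
have [fx fy] : f (val x) = val (root m') /\ f (val y) = val (tnth (marks m') ord_max).
  by case: fm.
rewrite /bival -/m' -fx -fy.
have Gx : vert G (val x) by exact: set_valP.
have Gy : vert G (val y) by exact: set_valP.
rewrite fa //; case: ifP => // xy.
apply/esym/(baire_covers bF); first by split=> //; right.
  split; last by right; rewrite fa.
  by have [fGH _ _] := fb; exact: fGH.
by move=> r; exact: iso_covers.
Qed.

End Measurability.

Section MassTransport.
Local Open Scope classical_set_scope.
Local Open Scope ereal_scope.
Variables (R : realType) (d : nat) (disp : measure_display)
  (Omega : measurableType disp) (P : probability Omega R) (T : Omega -> rooted_class d).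
Hypotheses (mT : measurable_fun [set: Omega] T) (uT : unimodular P T).
Implicit Types F : fnl R d.

Lemma measurable_rvalT F : baire F -> measurable_fun setT (fun w => rval F (T w)).
Proof. by move=> bF; apply: measurableT_comp => //; exact: measurable_rval. Qed.

Lemma esum_edges F (G : cgraph d) (x : set_type (vert G)) : nice F ->
  \esum_(y in [set: set_type (vert G)]) (bival F (birooted x y))%:E =
  (nsum F G (val x) (val x))%:E.
Proof.
move=> nF; have [bF _] := nF.
under eq_esum do rewrite bival_birooted //.
pose a y := (if adj G (val x) y then F G (val x) y else 0%R)%:E.
rewrite -(@reindex_esum _ _ _ setT (vert G) val a); last first.
  split=> [y _|y z _ _ /val_inj //|y Gy]; first exact: set_valP.
  by exists (SigSub (mem_set Gy)).
have -> : \esum_(y in vert G) a y =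
    \esum_(y in vert G `&` [set y | adj G (val x) y]) (F G (val x) y)%:E.
  rewrite esum_mkcondr; apply: eq_esum => y _; rewrite /a.
  by case: ifPn => [xy|xy]; [rewrite mem_set|rewrite memNset //; exact/negP].
have -> : vert G `&` [set y | adj G (val x) y] = [set y | adj G (val x) y].
  by apply/seteqP; split=> [y []//|y /= xy]; split=> //; exact: adj_vertr xy.
have fnb := nb_finite (@cgraph_degree _ G) (val x).
rewrite esum_fset //; last first.
  move=> y /set_mem /= xy; rewrite lee_fin; apply: (nice_ge0 nF).
  by split; [exact: adj_vert xy|right].
by rewrite fsbig_finite //= sumEFin.
Qed.

Lemma bival_swap F (G : cgraph d) (x y : set_type (vert G)) : baire F ->
  bival F (birooted y x) = bival (swap F) (birooted x y).
Proof.
move=> bF; rewrite !bival_birooted //; last exact: baire_swap.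
by rewrite adj_sym.
Qed.

Lemma esum_edges_in F (G : cgraph d) (x : set_type (vert G)) : nice F ->
  \esum_(y in [set: set_type (vert G)]) (bival F (birooted y x))%:E =
  (nsum (swap F) G (val x) (val x))%:E.
Proof.
move=> nF; rewrite -esum_edges; last exact: nice_swap.
by apply: eq_esum => y _; rewrite bival_swap //; case: nF.
Qed.

Lemma integral_rval_lt F : nice F -> \int[P]_w (rval F (T w))%:E < +oo.
Proof.
move=> nF; have [bF [M FM]] := nF.
apply: (@le_lt_trans _ _ (\int[P]_w M%:E)); last first.
  by rewrite integral_cst // [X in _ * X](_ : _ = 1) ?mule1 ?ltry //; exact: probability_setT.
apply: ge0_le_integral => //.
- by move=> w _; rewrite lee_fin; have /andP[] := FM _ _ _ (linked_root (repr (T w))).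
- by apply/measurable_EFinP; exact: measurable_rvalT.
- move=> w _; have /andP[? /(le_trans _)] := FM _ _ _ (linked_root (repr (T w))).
  by rewrite lee_fin; apply.
Qed.

Lemma mass_transport_edges F : nice F ->
  \int[P]_w (rval (nsum F) (T w))%:E = \int[P]_w (rval (nsum (swap F)) (T w))%:E.
Proof.
move=> nF; have [bF _] := nF.
have F0 : forall c, (0 <= bival F c)%R.
  move=> c; rewrite /bival; case: ifP => // xy; apply: (nice_ge0 nF).
  by split; [exact: root_vert|right].
have sentE : (\int[P]_w \esum_(x in [set: set_type (vert (graph_of (T w)))])
    (bival F (birooted (root (graph_of (T w))) x))%:E) =
    \int[P]_w (rval (nsum F) (T w))%:E.
  by apply: eq_integral => w _; rewrite esum_edges.
have recvE : (\int[P]_w \esum_(x in [set: set_type (vert (graph_of (T w)))])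
    (bival F (birooted x (root (graph_of (T w)))))%:E) =
    \int[P]_w (rval (nsum (swap F)) (T w))%:E.
  by apply: eq_integral => w _; rewrite esum_edges_in.
rewrite -sentE -recvE; apply: uT => //; first exact: measurable_bival.
by left; rewrite sentE; exact: integral_rval_lt (nice_nsum nF).
Qed.

End MassTransport.

(** * The adjacency operator and its moments *)

Section Expectation.
Local Open Scope classical_set_scope.
Variables (R : realType) (d : nat) (disp : measure_display)
  (Omega : measurableType disp) (P : probability Omega R) (T : Omega -> rooted_class d).
Hypotheses (mT : measurable_fun [set: Omega] T) (uT : unimodular P T).
Implicit Types F : fnl R d.

Definition mean F : R := fine (\int[P]_w (rval F (T w))%:E).

Lemma rval_ge0 F c : nice F -> 0 <= rval F c.
Proof. by move=> nF; exact: nice_ge0 (linked_root _). Qed.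

Lemma meanE F : nice F -> (mean F)%:E = (\int[P]_w (rval F (T w))%:E)%E.
Proof.
move=> nF; rewrite /mean fineK // ge0_fin_numE; first exact: integral_rval_lt.
by apply: integral_ge0 => w _; rewrite lee_fin rval_ge0.
Qed.

Lemma measurable_nice F : nice F -> measurable_fun setT (fun w => (rval F (T w))%:E).
Proof. by move=> [bF _]; apply/measurable_EFinP; exact: measurable_rvalT. Qed.

Lemma mean_le_ae F F' : nice F -> nice F' ->
  {ae P, forall w, rval F (T w) <= rval F' (T w)} -> mean F <= mean F'.
Proof.
move=> nF nF' le; rewrite -lee_fin !meanE //; apply: ae_ge0_le_integral => //.
- by move=> w _; rewrite lee_fin rval_ge0.
- exact: measurable_nice.
- by move=> w _; rewrite lee_fin rval_ge0.
- exact: measurable_nice.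
by apply: filterS le => w le _; rewrite lee_fin.
Qed.

Lemma mean_le F F' : nice F -> nice F' ->
  (forall (G : cgraph d) x, vert G x -> F G x x <= F' G x x) -> mean F <= mean F'.
Proof.
move=> nF nF' le; apply: mean_le_ae => //; apply: aeW => w; apply: le; exact: root_vert.
Qed.

Lemma mean_ext F F' : nice F ->
  (forall (G : cgraph d) x, vert G x -> F G x x = F' G x x) -> mean F = mean F'.
Proof.
move=> nF e; rewrite /mean; congr fine; apply: eq_integral => w _; congr EFin.
by apply: e; exact: root_vert.
Qed.

Lemma mean_add F F' : nice F -> nice F' ->
  mean (fun G x y => F G x y + F' G x y) = mean F + mean F'.
Proof.
move=> nF nF'; apply: EFin_inj; rewrite EFinD !meanE //; last exact: nice_add.
by rewrite -ge0_integralD //; [move=> w _; rewrite lee_fin rval_ge0| exact: measurable_nice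
  | move=> w _; rewrite lee_fin rval_ge0| exact: measurable_nice].
Qed.

Lemma mean_scale c F : 0 <= c -> nice F -> mean (fun G x y => c * F G x y) = c * mean F.
Proof.
move=> c0 nF; apply: EFin_inj; rewrite EFinM !meanE //; last first.
  by apply: nice_mul => //; exact: nice_cst.
by rewrite -ge0_integralZl //; [exact: measurable_nice|move=> w _; rewrite lee_fin rval_ge0].
Qed.

Lemma mean_cst c : mean (fun _ _ _ => c) = c.
Proof.
rewrite /mean (_ : (\int[P]_w (rval (fun _ _ _ => c) (T w))%:E)%E =
  (\int[P]_w (cst c%:E w))%E) // integral_cst //.
by rewrite [X in (_ * X)%E](_ : _ = 1%E) ?mule1 //; exact: probability_setT.
Qed.

Lemma mean_mass_transport F : nice F -> mean (nsum F) = mean (nsum (swap F)).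
Proof. by move=> nF; rewrite /mean mass_transport_edges. Qed.

End Expectation.

Section Operator.
Local Open Scope classical_set_scope.
Variables (R : realType) (d : nat).

Definition vfnl := cgraph d -> nat -> R.
Definition vlift (V : vfnl) : fnl R d := fun G x _ => V G x.

(** The adjacency operator with a potential: the vertex [x] of degree [n] gets the term
    [z (d - n) f x]. It has the effect of [d - n] infinite regular branches hanging at [x],
    on which [f] would decay by a factor [z] at each step away from [x]. *)
Definition Hop (z : R) (G : sgraph) (f : nat -> R) (x : nat) : R :=
  \sum_(w <- nb G x) f w + z * (d%:R - (#|` nb G x|)%:R) * f x.

Definition Hiter (z : R) (j : nat) (V : vfnl) : vfnl := fun G => iter j (Hop z G) (V G).

Lemma nice_degree_defect : nice (vlift (fun G x => d%:R - (#|` nb G x|)%:R)).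
Proof.
split; last first.
  exists d%:R => G x y xy; rewrite /vlift subr_ge0 ler_nat card_nb; last exact: cgraph_degree.
  by rewrite /= lerBlDr lerDl.
have : baire (fun (G : cgraph d) x y => d%:R - nsum (fun _ _ _ => 1 : R) G x y).
  apply: (baire_op2 (phi := fun a b => a - b)) => // [a b|b a||].
  - by apply: continuousB; [exact: cst_continuous|exact: id].
  - by apply: continuousB; [exact: id|exact: cst_continuous].
  - exact: baire_cst.
  - exact/baire_nsum/baire_cst.
move/baire_ext; apply => G x y _; rewrite /nsum /vlift.
by rewrite big_const_seq count_predT iter_addr_0.
Qed.

Lemma nice_other_end V : nice (vlift V) -> nice (fun G _ y => V G y : R).
Proof. exact: nice_swap. Qed.

Lemma nice_Hop z V : 0 <= z -> nice (vlift V) -> nice (vlift (fun G => Hop z G (V G))).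
Proof.
move=> z0 nV; apply: nice_add; first exact/nice_nsum/nice_other_end.
apply: nice_mul => //; apply: nice_mul; [exact: nice_cst|exact: nice_degree_defect].
Qed.

Lemma nice_Hiter z j V : 0 <= z -> nice (vlift V) -> nice (vlift (Hiter z j V)).
Proof. by move=> z0 nV; elim: j => [//|j IH]; exact: nice_Hop z0 IH. Qed.

Lemma HopD z (G : sgraph) f g x : Hop z G (fun u => f u + g u) x = Hop z G f x + Hop z G g x.
Proof. rewrite /Hop big_split /=; lra. Qed.

Lemma HopZ z (G : sgraph) c f x : Hop z G (fun u => c * f u) x = c * Hop z G f x.
Proof. rewrite /Hop -mulr_sumr; lra. Qed.

Lemma Hop_le z (G : cgraph d) f g x : 0 <= z -> (forall u, vert G u -> f u <= g u) ->
  vert G x -> Hop z G f x <= Hop z G g x.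
Proof.
move=> z0 fg Gx; rewrite /Hop lerD //.
  rewrite big_seq [leRHS]big_seq; apply: ler_sum => w.
  by rewrite (in_nb (@cgraph_degree _ G)) => /adj_vertr; exact: fg.
by rewrite ler_wpM2l ?fg // mulr_ge0 // subr_ge0 ler_nat (card_nb (@cgraph_degree _ G)).
Qed.

Lemma Hiter_le z j (G : cgraph d) f g x : 0 <= z -> (forall u, vert G u -> f u <= g u) ->
  vert G x -> iter j (Hop z G) f x <= iter j (Hop z G) g x.
Proof. by move=> z0 fg; elim: j x => [|j IH] x Gx /=; [exact: fg|exact: Hop_le]. Qed.

Lemma iterHopZ z j (G : sgraph) c f x :
  iter j (Hop z G) (fun u => c * f u) x = c * iter j (Hop z G) f x.
Proof.
elim: j x => //= j IH x; rewrite -HopZ; congr Hop; exact/funext.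
Qed.

Lemma iterHopD z j (G : sgraph) f g x :
  iter j (Hop z G) (fun u => f u + g u) x = iter j (Hop z G) f x + iter j (Hop z G) g x.
Proof.
elim: j x => //= j IH x; rewrite -HopD; congr Hop; exact/funext.
Qed.

Lemma iterHop0 z j (G : sgraph) x : iter j (Hop z G) (fun=> 0) x = 0.
Proof.
elim: j x => //= j IH x; rewrite /Hop big1 ?IH ?mulr0 ?addr0 // => w _; exact: IH.
Qed.

Lemma iterHop_sum z j (G : sgraph) (r : seq nat) (f : nat -> nat -> R) x :
  iter j (Hop z G) (fun u => \sum_(y <- r) f y u) x = \sum_(y <- r) iter j (Hop z G) (f y) x.
Proof.
elim: r => [|y r IH].
  rewrite big_nil -[RHS](iterHop0 z j G x); congr (iter _ _ _ _).
  by apply/funext => u; rewrite big_nil.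
rewrite big_cons -IH -iterHopD; congr (iter _ _ _ _).
by apply/funext => u; rewrite big_cons.
Qed.

End Operator.

Section Spectral.
Local Open Scope classical_set_scope.
Variables (R : realType) (d : nat) (disp : measure_display)
  (Omega : measurableType disp) (P : probability Omega R) (T : Omega -> rooted_class d).
Hypotheses (mT : measurable_fun [set: Omega] T) (uT : unimodular P T).
Implicit Types U V : vfnl R d.

Definition ip U V : R := mean P T (vlift (fun G x => U G x * V G x)).

Lemma nice_prod U V : nice (vlift U) -> nice (vlift V) ->
  nice (vlift (fun G x => U G x * V G x)).
Proof. exact: nice_mul. Qed.

Lemma ipC U V : ip U V = ip V U.
Proof.
rewrite /ip; congr mean; apply/funext => G; apply/funext => x; apply/funext => y.
by rewrite /vlift mulrC.
Qed.

Lemma ip_le U U' V V' : nice (vlift U) -> nice (vlift V) -> nice (vlift U') -> nice (vlift V') ->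
  (forall (G : cgraph d) x, vert G x -> U G x <= U' G x) ->
  (forall (G : cgraph d) x, vert G x -> V G x <= V' G x) -> ip U V <= ip U' V'.
Proof.
move=> nU nV nU' nV' UU VV; apply: mean_le => //; try exact: nice_prod.
move=> G x Gx; apply: ler_pM; [| |exact: UU|exact: VV].
  by apply: (@nice_ge0 _ _ (vlift U) G x x nU); split=> //; left.
by apply: (@nice_ge0 _ _ (vlift V) G x x nV); split=> //; left.
Qed.

Lemma ipDl U U' V : nice (vlift U) -> nice (vlift U') -> nice (vlift V) ->
  ip (fun G x => U G x + U' G x) V = ip U V + ip U' V.
Proof.
move=> nU nU' nV; rewrite /ip -mean_add //; try exact: nice_prod.
apply: mean_ext; last by move=> G x _; rewrite /vlift mulrDl.
by apply: nice_prod => //; exact: nice_add.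
Qed.

Lemma ipDr U V V' : nice (vlift U) -> nice (vlift V) -> nice (vlift V') ->
  ip U (fun G x => V G x + V' G x) = ip U V + ip U V'.
Proof. by move=> *; rewrite ipC ipDl // ![ip _ U]ipC. Qed.

Variable z : R.
Hypothesis z0 : 0 <= z.

Local Notation H := (fun V : vfnl R d => (fun G => Hop d z G (V G)) : vfnl R d).

(** The adjacency part is the mass transport principle for the mass [V x * U w] sent from
    [x] to its neighbour [w]; the potential is a multiplication. *)
Lemma Hop_sym U V : nice (vlift U) -> nice (vlift V) -> ip (H U) V = ip U (H V).
Proof.
move=> nU nV.
pose e : vfnl R d := fun G x => d%:R - (#|` nb G x|)%:R.
pose S W : vfnl R d := fun G x => \sum_(w <- nb G x) W G w.
have nS W : nice (vlift W) -> nice (vlift (S W)).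
  by move=> nW; exact/nice_nsum/nice_other_end.
have ne W : nice (vlift W) -> nice (vlift (fun G x => z * e G x * W G x)).
  move=> nW; apply: nice_mul => //; apply: nice_mul; [exact: nice_cst|exact: nice_degree_defect].
rewrite (_ : H U = fun G x => S U G x + z * e G x * U G x)//.
rewrite (_ : H V = fun G x => S V G x + z * e G x * V G x)//.
rewrite ipDl //; [|exact: nS|exact: ne]; rewrite ipDr //; [|exact: nS|exact: ne].
congr (_ + _); last first.
  rewrite /ip; congr mean; apply/funext => G; apply/funext => x; apply/funext => y.
  by rewrite /vlift; lra.
pose F : fnl R d := fun G x y => V G x * U G y.
have nF : nice F by apply: nice_mul => //; exact: nice_other_end.
have -> : ip (S U) V = mean P T (nsum F).
  rewrite /ip; congr mean; apply/funext => G; apply/funext => x; apply/funext => y.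
  by rewrite /vlift /nsum /F -mulr_sumr mulrC.
rewrite mean_mass_transport // /ip; congr mean.
apply/funext => G; apply/funext => x; apply/funext => y.
by rewrite /vlift /nsum /swap /F -mulr_suml mulrC.
Qed.

Lemma ip_Hiter i j U : nice (vlift U) ->
  ip (Hiter z i U) (Hiter z j U) = ip U (Hiter z (i + j) U).
Proof.
move=> nU; elim: i j => [//|i IH] j.
rewrite addSnnS -IH; exact: Hop_sym (nice_Hiter _ z0 nU) (nice_Hiter _ z0 nU).
Qed.

(** An increasing step of a convex sequence is followed by steps that are at least as
    large, so the sequence would be unbounded. *)
Lemma convex_bounded (b : nat -> R) (C : R) : (forall j, 2 * b j.+1 <= b j + b j.+2) ->
  (forall j, b j <= C) -> forall j, b j <= b 0%N.
Proof.
move=> cb bC; suff dec j : b j.+1 <= b j by elim=> [//|j IH]; exact: le_trans (dec j) IH.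
rewrite leNgt; apply/negP => lt.
have step n : b j.+1 - b j <= b (j + n).+1 - b (j + n)%N.
  elim: n => [|n IH]; first by rewrite addn0.
  by have := cb (j + n)%N; rewrite addnS; lra.
have lin n : b j + n%:R * (b j.+1 - b j) <= b (j + n)%N.
  elim: n => [|n IH]; first by rewrite addn0; lra.
  by rewrite addnS -natr1; have := step n; lra.
have := archi_boundP (_ : 0 <= (C - b j) / (b j.+1 - b j)).
rewrite divr_ge0 ?subr_ge0 ?bC //; last exact: ltW.
move=> /(_ isT); rewrite ltr_pdivrMr ?subr_gt0 // => lt'.
set n := Num.bound _ in lt' *; have := lin n; have := bC (j + n)%N; lra.
Qed.

Variable lam : R.
Hypothesis lam0 : 0 < lam.

Lemma ip_sq_le i j c U : 0 < c -> nice (vlift U) ->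
  2 * ip (Hiter z i U) (Hiter z j U) <=
  c * ip (Hiter z i U) (Hiter z i U) + c^-1 * ip (Hiter z j U) (Hiter z j U).
Proof.
move=> c0 nU; set A := Hiter z i U; set B := Hiter z j U.
have nA : nice (vlift A) by exact: nice_Hiter.
have nB : nice (vlift B) by exact: nice_Hiter.
have ci0 : 0 < c^-1 by rewrite invr_gt0.
have nAA := nice_prod nA nA; have nBB := nice_prod nB nB; have nAB := nice_prod nA nB.
rewrite /ip -!mean_scale //; try exact: ltW.
rewrite -mean_add //; try by apply: nice_mul => //; apply: nice_cst; exact: ltW.
apply: mean_le => //; first by apply: nice_mul => //; apply: nice_cst.
  by apply: nice_add; apply: nice_mul => //; apply: nice_cst; exact: ltW.
move=> G x Gx; rewrite /vlift; set a := A G x; set b := B G x.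
have -> : 2 * (a * b) = c * (a * a) + c^-1 * (b * b) - c * (a - c^-1 * b) ^+ 2.
  have -> : c * (a - c^-1 * b) ^+ 2 =
      c * (a * a) - 2 * (c * c^-1) * (a * b) + (c * c^-1) * (c^-1 * (b * b)).
    rewrite expr2; lra.
  by rewrite mulfV ?gt_eqF //; lra.
by rewrite gerBl mulr_ge0 ?sqr_ge0 // ltW.
Qed.

Lemma moments_of_even U : nice (vlift U) ->
  (forall j, ip (Hiter z j U) (Hiter z j U) <= lam ^+ (j + j)) ->
  forall j, ip U (Hiter z j U) <= lam ^+ j.
Proof.
move=> nU b j; have [i [->|->]] : exists i, j = (i + i)%N \/ j = (i + i.+1)%N.
  by exists j./2; lia.
  by rewrite -ip_Hiter.
rewrite -ip_Hiter //; have := ip_sq_le i i.+1 lam0 nU.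
have := b i; have := b i.+1.
set B := ip (Hiter z i.+1 U) _; set A := ip (Hiter z i U) (Hiter z i U).
set D := ip _ _ => hB hA hD.
have : lam * A <= lam ^+ (i + i.+1) by rewrite addnS exprS ler_wpM2l // ltW.
have : lam^-1 * B <= lam ^+ (i + i.+1).
  rewrite ler_pdivrMl // -exprS; apply: le_trans hB _.
  by rewrite addSn.
lra.
Qed.

(** The top of the spectrum, as seen by [U], is determined by the exponential growth rate
    of the moments, so the constant [C] can be replaced by the squared norm of [U]. The
    normalized even moments form a convex sequence, by symmetry of [H], which is bounded
    and therefore decreases. *)
Lemma moments_le C U : nice (vlift U) ->
  (forall (G : cgraph d) x, vert G x -> U G x <= 1) ->
  (forall j, ip U (Hiter z j U) <= C * lam ^+ j) ->
  forall j, ip U (Hiter z j U) <= lam ^+ j.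
Proof.
move=> nU U1 UC; apply: moments_of_even => // j.
pose b j := ip (Hiter z j U) (Hiter z j U) / lam ^+ (j + j).
have lamX k : 0 < lam ^+ k by rewrite exprn_gt0.
suff : b j <= 1 by rewrite /b ler_pdivrMr // mul1r.
apply: (@le_trans _ _ (b 0%N)).
  apply: (convex_bounded (C := C)) => {j} j; last first.
    by rewrite /b ler_pdivrMr // ip_Hiter.
  rewrite /b.
  have -> : ip (Hiter z j.+1 U) (Hiter z j.+1 U) = ip (Hiter z j U) (Hiter z j.+2 U).
    by rewrite !ip_Hiter // addSnnS.
  have := @ip_sq_le j j.+2 (lam ^+ 2) U (lamX 2%N) nU.
  set X := ip _ _; set A := ip (Hiter z j U) (Hiter z j U); set B := ip _ _ => h.
  have -> : (j.+1 + j.+1 = 2 + (j + j))%N by lia.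
  have -> : (j.+2 + j.+2 = 2 + 2 + (j + j))%N by lia.
  move: (j + j)%N => k; rewrite !exprD; have := lamX 2%N; have := lamX k.
  move: (lam ^+ 2) (lam ^+ k) h => l m h m0 l0.
  rewrite mulrA ler_pdivrMr ?mulr_gt0 // [leRHS]mulrDl.
  have -> : A / m * (l * m) = l * A by rewrite mulrCA mulfVK ?gt_eqF // mulrC.
  have -> // : B / (l * l * m) * (l * m) = l^-1 * B.
  rewrite !invfM -!mulrA [m^-1 * (l * m)]mulrCA mulVf ?gt_eqF // mulr1.
  by rewrite mulVf ?gt_eqF // mulr1 mulrC.
rewrite /b addn0 expr0 divr1.
have n1 : nice ((fun _ _ _ => 1) : fnl R d) by apply: nice_cst; exact: ler01.
apply: (@le_trans _ _ (mean P T (fun _ _ _ => 1))); last by rewrite mean_cst.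
apply: mean_le => //; first exact: nice_prod.
move=> G x Gx; rewrite /vlift /=; have U0 : 0 <= U G x.
  by apply: (@nice_ge0 _ _ (vlift U) G x x nU); split=> //; left.
by rewrite mulr_ile1 ?U1.
Qed.

End Spectral.

(** * The adjacency operator of a tree and its spheres *)

Section TreeOperator.
Local Open Scope classical_set_scope.
Variables (R : realType) (d : nat) (G : cgraph d) (tG : is_tree G).
Hypothesis d1 : (1 <= d)%N.
Implicit Types (z a : R) (x y : nat).

Let dG := @cgraph_degree d G.
Local Notation HG z := (Hop d z G).

(** [rate a = a^-1 + (d - 1) a] is the eigenvalue of the adjacency operator of the
    [d]-regular tree away from [y], for the function [a ^+ dist u y] of [u]. *)
Definition rate (a : R) : R := a^-1 + (d%:R - 1) * a.

Lemma rate_gt0 a : 0 < a -> 0 < rate a.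
Proof.
by move=> a0; rewrite ltr_pwDl ?invr_gt0 // mulr_ge0 ?(ltW a0) // subr_ge0 ler1n.
Qed.

(** [rate] decreases up to [(d - 1)^(-1/2)]: this is where the critical growth
    [sqrt (d - 1)] comes from. *)
Lemma rate_decr z a : 0 < a -> a < z -> (d%:R - 1) * z ^+ 2 < 1 -> rate z < rate a.
Proof.
move=> a0 az zq; have z0 := lt_trans a0 az.
have q0 : 0 <= d%:R - 1 :> R by rewrite subr_ge0 ler1n.
rewrite /rate -subr_gt0; set q := d%:R - 1 in zq q0 *.
have -> : a^-1 + q * a - (z^-1 + q * z) = (z - a) * (a^-1 / z - q).
  have -> : (z - a) * (a^-1 / z - q) = (z / z) * a^-1 - (a / a) * z^-1 - q * (z - a).
    lra.
  by rewrite !mulfV ?gt_eqF //; lra.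
rewrite mulr_gt0 ?subr_gt0 // ltr_pdivlMr // -[a^-1]mul1r ltr_pdivlMr //.
apply: le_lt_trans zq; rewrite expr2 mulrA ler_wpM2l ?mulr_ge0 ?(ltW z0) //.
exact: ltW.
Qed.

Lemma nb_geom a x y : vert G x -> vert G y -> x != y ->
  exists k, dist G x y = k.+1 /\ \sum_(w <- nb G x) a ^+ dist G w y =
    a ^+ k + ((#|` nb G x|)%:R - 1) * a ^+ k.+2.
Proof.
move=> Gx Gy xy; have [b [xb dxy far]] := dist_nbr tG Gx Gy xy.
have bx : b \in nb G x by rewrite (in_nb dG).
exists (dist G b y); split=> //.
rewrite (big_fsetD1 b) //=; congr (_ + _).
rewrite (eq_big_seq (fun=> a ^+ (dist G b y).+2)); last first.
  by move=> w; rewrite !inE (in_nb dG) => /andP[wb xw]; rewrite far // dxy.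
rewrite big_const_seq count_predT iter_addr_0 -[LHS]mulr_natl; congr (_ * _).
by have := cardfsD1 b (nb G x); rewrite bx /= => ->; rewrite natrD addrC addKr.
Qed.

(** Off [y] this is an equality: one neighbour is closer to [y], the others are further
    away, and the potential stands for the missing ones. *)
Lemma Hop_geom_le z x y : 0 < z -> z <= 1 -> vert G x -> vert G y ->
  HG z (fun u => z ^+ dist G u y) x <= rate z * z ^+ dist G x y.
Proof.
move=> z0 z1 Gx Gy; rewrite /Hop.
have [<-|xy] := eqVneq x y.
  rewrite (eq_big_seq (fun=> z)); last first.
    by move=> w; rewrite (in_nb dG) => xw; rewrite (dist_adj tG) ?expr1 // adj_sym.
  rewrite (distxx tG) expr0 !mulr1 big_const_seq count_predT iter_addr_0 -[z *+ _]mulr_natl /rate.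
  have : 1 <= z^-1 by rewrite invf_ge1.
  lra.
have [k [-> ->]] := nb_geom z Gx Gy xy.
rewrite /rate !exprS [leRHS]mulrDl !mulrA mulVf ?gt_eqF // mul1r.
move: (#|` nb G x|%:R) (z ^+ k) => n t; lra.
Qed.

Lemma Hop_geom_ge z a x y : 0 <= a -> a <= z -> 0 < a -> vert G x -> vert G y -> x != y ->
  rate a * a ^+ dist G x y <= HG z (fun u => a ^+ dist G u y) x.
Proof.
move=> a0 az a0' Gx Gy xy; rewrite /Hop.
have [k [-> ->]] := nb_geom a Gx Gy xy.
rewrite /rate !exprS [leLHS]mulrDl !mulrA mulVf ?gt_eqF // mul1r.
have t0 : 0 <= a ^+ k by rewrite exprn_ge0.
have n0 : 0 <= d%:R - (#|` nb G x|)%:R :> R.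
  by rewrite subr_ge0 ler_nat (card_nb dG).
rewrite -subr_ge0; set n := (#|` nb G x|)%:R in n0 *.
suff -> : forall t, t + (n - 1) * a * a * t + z * (d%:R - n) * a * t -
    (t + (d%:R - 1) * a * a * t) = (z - a) * (d%:R - n) * a * t.
  by rewrite !mulr_ge0 // subr_ge0.
move=> t; lra.
Qed.

Lemma iterHop_geom_le z j x y : 0 < z -> z <= 1 -> vert G x -> vert G y ->
  iter j (HG z) (fun u => z ^+ dist G u y) x <= rate z ^+ j * z ^+ dist G x y.
Proof.
move=> z0 z1 Gx Gy; elim: j x Gx => [|j IH] x Gx /=; first by rewrite mul1r.
apply: le_trans (Hop_le (ltW z0) IH Gx) _.
rewrite HopZ exprS [_ * rate _ ^+ _]mulrC -mulrA ler_wpM2l ?Hop_geom_le //.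
by rewrite exprn_ge0 // ltW // rate_gt0.
Qed.

Definition delta y : nat -> R := fun u => (u == y)%:R.

Lemma delta_le_geom z x y : 0 <= z -> delta y x <= z ^+ dist G x y.
Proof.
move=> z0; rewrite /delta; case: eqP => [->|_]; last exact: exprn_ge0.
by rewrite distxx.
Qed.

Lemma iterHop_delta_le z j x y : 0 < z -> z <= 1 -> vert G x -> vert G y ->
  iter j (HG z) (delta y) x <= rate z ^+ j * z ^+ dist G x y.
Proof.
move=> z0 z1 Gx Gy; apply: le_trans (iterHop_geom_le j z0 z1 Gx Gy).
by apply: Hiter_le => // [|u Gu]; [exact: ltW|apply: delta_le_geom; exact: ltW].
Qed.

(** The function [g = a ^+ dist u y] satisfies [g <= delta y + (rate a)^-1 H g], as [a] is
    at most the parameter [z] of the potential. Iterating this inequality leaves the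
    remainder [(rate a)^-J H^J g], and [g] is at most [z ^+ dist u y]. *)
Lemma iterHop_delta_ge z a J x y : 0 < a -> a <= z -> z <= 1 -> vert G x -> vert G y ->
  a ^+ dist G x y <= \sum_(j < J) (rate a)^-1 ^+ j * iter j (HG z) (delta y) x +
    (rate z / rate a) ^+ J * z ^+ dist G x y.
Proof.
move=> a0 az z1 Gx Gy; have z0 := lt_le_trans a0 az.
pose g u := a ^+ dist G u y.
have ra0 := rate_gt0 a0.
have step u : vert G u -> g u <= delta y u + (rate a)^-1 * HG z g u.
  move=> Gu; have [->|uy] := eqVneq u y.
    rewrite /g /delta distxx // eqxx expr0 lerDl mulr_ge0 ?invr_ge0 ?(ltW ra0) //.
    rewrite addr_ge0 //; first by apply: sumr_ge0 => w _; rewrite exprn_ge0 // ltW.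
    rewrite !mulr_ge0 ?(ltW z0) ?exprn_ge0 ?(ltW a0) // subr_ge0 ler_nat; exact: card_nb dG _.
  rewrite /delta (negbTE uy) add0r ler_pdivlMl //; apply: Hop_geom_ge => //; exact: ltW.
apply: (@le_trans _ _ (\sum_(j < J) (rate a)^-1 ^+ j * iter j (HG z) (delta y) x +
    (rate a)^-1 ^+ J * iter J (HG z) g x)).
  elim: J => [|J IH]; first by rewrite big_ord0 add0r mul1r.
  apply: le_trans IH _; rewrite big_ord_recr /= -addrA lerD2l.
  rewrite exprSr -mulrA -mulrDr ler_wpM2l ?exprn_ge0 ?invr_ge0 ?(ltW ra0) //.
  apply: le_trans (Hiter_le J (ltW z0) step Gx) _.
  by rewrite iterHopD iterHopZ -iterSr.
rewrite lerD2l exprMn [rate z ^+ _ * _]mulrC -mulrA ler_wpM2l ?exprn_ge0 ?invr_ge0 ?(ltW ra0) //.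
apply: le_trans (iterHop_geom_le J z0 z1 Gx Gy); apply: Hiter_le => // [|u Gu]; first exact: ltW.
by rewrite lerXn2r // nnegrE ltW.
Qed.

Lemma iterHop_le_local z f g j n x u : 0 <= z ->
  (forall v, ball G x (n + j) v -> f v <= g v) -> ball G x n u ->
  iter j (HG z) f u <= iter j (HG z) g u.
Proof.
move=> z0; elim: j n u => [|j IH] n u fg Bu /=; first by apply: fg; rewrite addn0.
have {}IH w v : ball G x w v -> (w <= n.+1)%N -> iter j (HG z) f v <= iter j (HG z) g v.
  move=> Bv wn; apply: (IH n.+1); last exact: ball_le Bv.
  by move=> v'; rewrite addSnnS; exact: fg.
rewrite /Hop lerD //.
  rewrite big_seq [leRHS]big_seq; apply: ler_sum => w.
  by rewrite (in_nb dG) => uw; apply: (IH n.+1) => //; exact: ball_adj Bu uw.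
rewrite ler_wpM2l //; last exact: IH Bu _.
by rewrite mulr_ge0 // subr_ge0 ler_nat (card_nb dG).
Qed.

Lemma geom_sum_le (r : R) n : 0 <= r < 1 -> \sum_(i < n) r ^+ i <= (1 - r)^-1.
Proof.
move=> /andP[r0 r1]; have q0 : 0 < 1 - r by rewrite subr_gt0.
rewrite -[leRHS]mul1r ler_pdivlMr //.
have -> : (\sum_(i < n) r ^+ i) * (1 - r) = 1 - r ^+ n.
  by rewrite mulrC -opprB mulNr -subrX1 opprB.
by rewrite lerBlDr lerDl exprn_ge0.
Qed.

Lemma le_geometric_limit (r c K b : R) : 0 <= r < 1 ->
  (forall J, b <= K + r ^+ J * c) -> b <= K.
Proof.
move=> /andP[r0 r1] h.
have cv : (fun J => K + r ^+ J * c) @ \oo --> K + 0 * c.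
  apply: cvgD; first exact: cvg_cst.
  by apply: cvgMl; apply: cvg_expr; rewrite ger0_norm.
rewrite mul0r addr0 in cv; rewrite -(cvg_lim _ cv) //.
by apply: limr_ge; [apply: cvgP cv|exact: nearW].
Qed.

Definition sphere (x n : nat) : {fset nat} :=
  fset_set [set y | vert G y /\ dist G x y = n].

Lemma in_sphere x n y : vert G x -> (y \in sphere x n) = `[< vert G y /\ dist G x y = n >].
Proof.
move=> Gx; rewrite /sphere in_fset_set.
  by apply/idP/asboolP => [/set_mem|?]; [|exact/mem_set].
apply: sub_finite_set (ball_finite dG x n) => u [Gu du].
by apply/ballP => //; rewrite du.
Qed.

(** Sum [iterHop_delta_ge] over the sphere; the remainder vanishes in the limit because
    [rate z < rate a]. *)
Lemma sphere_le z a n K x : 0 < a -> a < z -> z <= 1 -> (d%:R - 1) * z ^+ 2 < 1 ->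
  vert G x ->
  (forall J, \sum_(j < J) (rate a)^-1 ^+ j *
    iter j (HG z) (fun u => \sum_(y <- sphere x n) delta y u) x <= K) ->
  (#|` sphere x n|)%:R * a ^+ n <= K.
Proof.
move=> a0 az z1 zq Gx hK; have z0 := lt_trans a0 az.
have ra0 := rate_gt0 a0; have rz0 := rate_gt0 z0.
apply: (@le_geometric_limit (rate z / rate a) ((#|` sphere x n|)%:R * z ^+ n)).
  by rewrite divr_ge0 ?(ltW ra0) ?(ltW rz0) //= ltr_pdivrMr // mul1r rate_decr.
move=> J.
have sE (b : R) : (#|` sphere x n|)%:R * b ^+ n = \sum_(y <- sphere x n) b ^+ dist G x y.
  rewrite [RHS](eq_big_seq (fun=> b ^+ n)).
    by rewrite big_const_seq count_predT iter_addr_0 mulr_natl.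
  by move=> y; rewrite in_sphere // => /asboolP[_ ->].
rewrite sE.
apply: (@le_trans _ _ (\sum_(y <- sphere x n) (\sum_(j < J) (rate a)^-1 ^+ j *
   iter j (HG z) (delta y) x + (rate z / rate a) ^+ J * z ^+ dist G x y))).
  rewrite big_seq [leRHS]big_seq; apply: ler_sum => y.
  by rewrite in_sphere // => /asboolP[Gy _]; apply: iterHop_delta_ge => //; exact: ltW.
rewrite big_split /= sE -mulr_sumr lerD2r; apply: le_trans (hK J).
rewrite exchange_big /=; apply: ler_sum => j _.
by rewrite iterHop_sum mulr_sumr.
Qed.

(** [H^j f x] only sees the vertices of [A] within distance [j] of [x], and each of them
    contributes at most [rate z ^+ j * z ^+ dist x y]. *)
Lemma iterHop_indic_le z (s C : R) (A : set nat) (f : nat -> R) x j :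
  0 < z -> z <= 1 -> 0 <= s -> s * z < 1 -> vert G x ->
  (forall u, vert G u -> f u <= 1) -> (forall u, vert G u -> ~ A u -> f u <= 0) ->
  (forall n, (#|` fset_set (A `&` ball G x n)|)%:R <= C * s ^+ n) ->
  iter j (HG z) f x <= C / (1 - s * z) * rate z ^+ j.
Proof.
move=> z0 z1 s0 sz Gx f1 fA hC.
have C0 : 0 <= C by have := hC 0%N; rewrite expr0 mulr1; apply: le_trans.
have fB n : finite_set (A `&` ball G x n) by apply: finite_setIr; exact: ball_finite dG x n.
have inB n u : (u \in fset_set (A `&` ball G x n)) = `[< A u /\ vert G u /\ (dist G x u <= n)%N >].
  rewrite in_fset_set //; apply/idP/asboolP => [/set_mem[Au /(ballP tG n u Gx)]//|[Au H]].
  by apply/mem_set; split=> //; apply/ballP.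
set F := fset_set (A `&` ball G x j).
apply: (@le_trans _ _ (iter j (HG z) (fun u => \sum_(y <- F) delta y u) x)).
  apply: (iterHop_le_local (n := 0)); [exact: ltW| |exact: ball_self].
  move=> v Bv; have Gv := ball_vert Bv.
  have [Av|nAv] := pselect (A v); last first.
    by apply: le_trans (fA _ Gv nAv) _; apply: sumr_ge0 => y _; rewrite /delta ler0n.
  have vF : v \in F by rewrite /F in_fset_set //; apply/mem_set.
  rewrite (big_fsetD1 v) //= {1}/delta eqxx; apply: le_trans (f1 _ Gv) _.
  by rewrite lerDl; apply: sumr_ge0 => y _; rewrite /delta ler0n.
rewrite iterHop_sum.
apply: (@le_trans _ _ (\sum_(y <- F) rate z ^+ j * z ^+ dist G x y)).
  rewrite big_seq [leRHS]big_seq; apply: ler_sum => y.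
  by rewrite inB => /asboolP[_ [Gy _]]; exact: iterHop_delta_le.
rewrite -mulr_sumr mulrC ler_wpM2r ?exprn_ge0 ?(ltW (rate_gt0 z0)) //.
apply: (@le_trans _ _ (\sum_(n < j.+1) C * (s * z) ^+ n)); last first.
  by rewrite -mulr_sumr ler_wpM2l // geom_sum_le // mulr_ge0 // ltW.
apply: (@le_trans _ _ (\sum_(n < j.+1) \sum_(y <- F | dist G x y == n) z ^+ n)).
  rewrite (exchange_big_dep predT) //= big_seq [leRHS]big_seq; apply: ler_sum => y.
  rewrite inB => /asboolP[_ [_ yj]].
  rewrite (bigD1 (Ordinal (yj : (dist G x y < j.+1)%N))) //= lerDl.
  by apply: sumr_ge0 => *; rewrite exprn_ge0 // ltW.
apply: ler_sum => n _.
rewrite big_const_seq iter_addr_0 exprMn mulrA -mulr_natl ler_wpM2r ?exprn_ge0 ?(ltW z0) //.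
apply: le_trans (hC n); rewrite ler_nat -size_filter.
apply: uniq_leq_size; first by rewrite filter_uniq.
move=> u; rewrite mem_filter inB => /andP[/eqP <- +]; rewrite inB => /asboolP[? [? _]].
by apply/asboolP.
Qed.

End TreeOperator.

(** * Upper exponential growth of a sequence *)

Section Growth.
Local Open Scope classical_set_scope.
Variable R : realType.
Implicit Types (u : (\bar R)^nat) (b : nat -> nat) (s : R).

Lemma limn_esup_le_near u (e : \bar R) N : (forall n, (N <= n)%N -> (u n <= e)%E) ->
  (limn_esup u <= e)%E.
Proof.
move=> uN; rewrite /limn_esup /limf_esup.
apply: (@le_trans _ _ (ereal_sup (u @` [set n | (N <= n)%N]))).
  by apply: ereal_inf_lbound; exists [set n | (N <= n)%N] => //; exists N.
by apply: ge_ereal_sup => _ [n /= Nn <-]; exact: uN.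
Qed.

Lemma limn_esup_lt_near u (e : \bar R) : (limn_esup u < e)%E ->
  exists N, forall n, (N <= n)%N -> (u n <= e)%E.
Proof.
move=> /ereal_inf_lt[_ [V [N _ NV] <-] Ve]; exists N => n Nn.
apply: le_trans (ltW Ve); apply: ereal_sup_ubound; exists n => //; exact: NV.
Qed.

Definition exp_growth b : \bar R := limn_esup (fun n => (((b n)%:R : R) `^ n%:R^-1)%:E).

Lemma root_le (x y : R) n : 0 <= x -> 0 <= y -> (0 < n)%N ->
  (x `^ n%:R^-1 <= y) = (x <= y ^+ n).
Proof.
move=> x0 y0 n0.
have nn0 : (n%:R : R) != 0 by rewrite pnatr_eq0 -lt0n.
have xE : (x `^ n%:R^-1) ^+ n = x.
  by rewrite -powR_mulrn ?powR_ge0 // -powRrM mulVf // powRr1.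
rewrite -{2}xE ler_pXn2r // nnegrE ?powR_ge0 //.
Qed.

Lemma exp_growth_le b C s : 0 < s -> (forall n, (b n)%:R <= C * s ^+ n) ->
  (exp_growth b <= s%:E)%E.
Proof.
move=> s0 bC; apply/lee_addgt0Pr => e e0; rewrite -EFinD.
have es0 : 0 < e / s by rewrite divr_gt0.
have C0 : 0 <= C by have := bC 0%N; rewrite expr0 mulr1; apply: le_trans.
pose N := Num.bound (C / (e / s)).
apply: (@limn_esup_le_near _ _ N.+1) => n Nn; rewrite lee_fin root_le //; first last.
- exact: leq_trans Nn.
- by rewrite addr_ge0 // ltW.
apply: le_trans (bC n) _.
have -> : s + e = (1 + e / s) * s by rewrite mulrDl mul1r mulfVK // gt_eqF.
rewrite exprMn ler_wpM2r ?exprn_ge0 ?(ltW s0) //.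
apply: (@le_trans _ _ (1 + n%:R * (e / s))); last first.
  elim: n {Nn} => [|n IH]; first by rewrite mul0r addr0.
  rewrite exprS; have h := ltW es0; have n0 : 0 <= n%:R :> R by [].
  apply: le_trans (ler_wpM2l _ IH); last by rewrite addr_ge0.
  rewrite -natr1; move: (e / s) (n%:R : R) h n0 => h m h0 m0.
  have : 0 <= m * h * h by rewrite !mulr_ge0.
  lra.
have : C / (e / s) < N%:R by apply: archi_boundP; rewrite divr_ge0 // ltW.
rewrite ltr_pdivrMr // => lt; apply: le_trans (ltW lt) _.
apply: (@le_trans _ _ (n%:R * (e / s))); last by rewrite lerDr.
by rewrite ler_pM2r // ler_nat ltnW.
Qed.

Lemma exp_growth_lt b s : 0 < s -> (exp_growth b < s%:E)%E ->
  exists C, forall n, (b n)%:R <= C * s ^+ n.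
Proof.
move=> s0 /limn_esup_lt_near[N bN].
exists (1 + \sum_(n < N.+1) (b n)%:R / s ^+ n) => n.
have sn0 : 0 < s ^+ n by rewrite exprn_gt0.
have t0 (k : 'I_N.+1) : 0 <= (b k)%:R / s ^+ k :> R.
  by rewrite divr_ge0 // exprn_ge0 // ltW.
have S0 : 0 <= \sum_(n < N.+1) (b n)%:R / s ^+ n :> R by apply: sumr_ge0.
have [nN|Nn] := ltnP n N.+1.
  rewrite -ler_pdivrMr // (bigD1 (Ordinal nN)) //= addrCA lerDl.
  by rewrite addr_ge0 // sumr_ge0.
rewrite mulrDl mul1r; apply: (@le_trans _ _ (s ^+ n)).
  have := bN n (ltnW Nn); rewrite lee_fin root_le //; first exact: ltW.
  exact: leq_trans Nn.
by rewrite lerDl mulr_ge0 // ltW.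
Qed.

Lemma growth_fromE (G : sgraph) x :
  growth_from R G x = exp_growth (fun n => #|` fset_set (ball G x n)|).
Proof. by []. Qed.

End Growth.

(** * The core as a functional *)

Section CoreFunctional.
Local Open Scope classical_set_scope.
Variables (R : realType) (d : nat).

(** On a tree, [escape j] is the indicator function of [long_side j] ([escape_tree]). *)
Fixpoint escape (j : nat) : fnl R d :=
  if j is j'.+1 then
    fun G x y => clamp (nsum (swap (escape j')) G x y - swap (escape j') G x y)
  else fun _ _ _ => 1.

Lemma nice_escape j : nice (escape j).
Proof.
elim: j => [|j IH]; first exact: nice_cst ler01.
by apply: nice_clampB; [exact/nice_nsum/nice_swap|exact: nice_swap].
Qed.

Definition fin_side : fnl R d := fun G x y => clamp (1 - finf escape G x y).

Lemma nice_fin_side : nice fin_side.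
Proof.
by apply: nice_clampB; [exact: nice_cst ler01|exact: nice_finf nice_escape].
Qed.

Definition core : vfnl R d := fun G x => clamp (1 - nsum fin_side G x x).

Lemma nice_core : nice (vlift core).
Proof.
by apply: nice_clampB; [exact: nice_cst ler01|exact: nice_nsum nice_fin_side].
Qed.

Lemma sum01_clamp (r : seq nat) (f : nat -> R) : {in r, forall w, f w = 0 \/ f w = 1} ->
  clamp (\sum_(w <- r) f w) = (has (fun w => f w == 1) r)%:R.
Proof.
elim: r => [|a r IH] f01; first by rewrite big_nil clamp0.
have IHr : {in r, forall w, f w = 0 \/ f w = 1}.
  by move=> w wr; apply: f01; rewrite inE wr orbT.
rewrite big_cons /=; have [->|->] := f01 a (mem_head _ _).
  by rewrite add0r eq_sym oner_eq0 IH.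
rewrite eqxx clamp1 // lerDl big_seq sumr_ge0 // => w /IHr[->|->] //; exact: ler01.
Qed.

Section OnTree.
Variables (G : cgraph d) (tG : is_tree G).
Let dG := @cgraph_degree d G.

Lemma escape_tree j x y : adj G x y -> escape j G x y = `[< long_side G j x y >]%:R.
Proof.
elim: j x y => [|j IH] x y xy.
  rewrite asboolT //; exists [::]; split=> //=.
  by rewrite inE andbT eq_sym (adj_neq xy).
have yn : y \in nb G x by rewrite (in_nb dG).
rewrite /= /nsum /swap (big_fsetD1 y) //= addrAC subrr add0r sum01_clamp; last first.
  move=> w; rewrite !inE (in_nb dG) => /andP[_ xw]; rewrite IH 1?adj_sym //.
  by case: `[< _ >]; [right|left].
congr (_ %:R); congr nat_of_bool; apply/hasP/asboolP.
  move=> [w]; rewrite !inE (in_nb dG) => /andP[wy xw]; rewrite IH 1?adj_sym // => e.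
  apply/(long_sideS tG) => //; exists w; split=> //.
  by move: e; case: asboolP => // _; rewrite eq_sym oner_eq0.
move=> /(long_sideS tG _ xy)[w [xw wy l]]; exists w; first by rewrite !inE wy (in_nb dG).
by rewrite IH 1?adj_sym // asboolT.
Qed.

Lemma fin_side_tree x y : adj G x y -> fin_side G x y = `[< finite_set (side G x y) >]%:R.
Proof.
move=> xy; rewrite /fin_side /finf.
have lb : lbound (range (fun n => escape n G x y)) 0.
  by move=> _ [n _ <-]; rewrite escape_tree.
have [f|i] := pselect (finite_set (side G x y)).
  rewrite asboolT //; have [j Nj] := (side_finiteP dG tG xy).1 f.
  suff -> : inf (range (fun n => escape n G x y)) = 0 by rewrite subr0 clamp1.
  apply/eqP; rewrite eq_le; apply/andP; split; last first.
    by apply: lb_le_inf => //; exists (escape 0 G x y); exists 0%N.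
  apply: ge_inf; first by exists 0.
  by exists j => //; rewrite escape_tree // asboolF.
rewrite asboolF //.
suff -> : (fun n => escape n G x y) = (fun=> 1).
  suff -> : range (fun _ : nat => 1 : R) = [set 1] by rewrite inf1 subrr clamp0.
  by apply/seteqP; split=> [_ [n _ <-]//|_ ->]; exists 0%N.
apply/funext => n; rewrite escape_tree // asboolT //.
by apply: contrapT => Nn; apply: i; apply/(side_finiteP dG tG xy); exists n.
Qed.

Lemma core_tree x : vert G x -> core G x = `[< in_core G x >]%:R.
Proof.
move=> Gx; rewrite /core /nsum.
have f01 : {in nb G x, forall w, fin_side G x w = 0 \/ fin_side G x w = 1}.
  by move=> w; rewrite (in_nb dG) => xw; rewrite fin_side_tree //; case: asboolP; [right|left].
have [c|nc] := pselect (in_core G x).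
  rewrite asboolT // big1_seq ?subr0 ?clamp1 // => w /andP[_].
  rewrite (in_nb dG) => xw; rewrite fin_side_tree // asboolF //; exact: c.2.
rewrite asboolF // clamp0 // subr_le0.
have [a [xa fa _]] := finite_side_dir tG Gx nc.
rewrite (big_fsetD1 a) ?(in_nb dG) //= fin_side_tree // asboolT // lerDl.
rewrite big_seq sumr_ge0 // => w; rewrite !inE => /andP[_ /f01[->|->]] //; exact: ler01.
Qed.

End OnTree.
End CoreFunctional.

Section Fatou.
Local Open Scope classical_set_scope.
Variables (R : realType) (d : nat) (disp : measure_display)
  (Omega : measurableType disp) (P : probability Omega R) (T : Omega -> rooted_class d).
Hypotheses (mT : measurable_fun [set: Omega] T) (uT : unimodular P T) (d1 : (1 <= d)%N).

(** Fatou: the lower limit of the [Y m] is integrable, hence almost surely finite. *)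
Lemma ae_einf_lt (Y : nat -> fnl R d) (K : R) : (forall m, nice (Y m)) ->
  (forall m, mean P T (Y m) <= K) ->
  {ae P, forall w, exists L, forall N, exists2 m, (N <= m)%N & rval (Y m) (T w) <= L}.
Proof.
move=> nY YK; pose f m w := (rval (Y m) (T w))%:E.
have mf m : measurable_fun setT (f m) by exact: measurable_nice.
have f0 m w : setT w -> (0 <= f m w)%E by rewrite lee_fin rval_ge0.
have fat := fatou P measurableT mf f0.
have le : (limn_einf (fun n => \int[P]_(x in setT) f n x) <= K%:E)%E.
  apply: le_trans (limn_einf_sup _) _; apply: (@limn_esup_le_near _ _ _ 0%N) => n _.
  by rewrite -meanE // lee_fin.
have einf_ge w L N : (forall m, (N <= m)%N -> (L <= f m w)%E) -> (L <= limn_einf (f ^~ w))%E.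
  move=> Lf; rewrite /limn_einf leeNr; apply: (@limn_esup_le_near _ _ _ N) => m Nm.
  by rewrite leeN2 Lf.
have g0 w : (0 <= limn_einf (f ^~ w))%E by apply: (@einf_ge w 0%E 0%N) => m _; exact: f0.
have ig : P.-integrable setT (fun w => limn_einf (f ^~ w)).
  apply/integrableP; split.
    apply: (measurableT_comp (f := -%E)) => //.
    by apply: measurable_fun_limn_esup => m; apply: measurableT_comp.
  under eq_integral do rewrite gee0_abs //.
  exact: le_lt_trans (le_trans fat le) (ltry _).
have := integrable_ae measurableT ig; apply: filterS => w /(_ I) fw.
exists (fine (limn_einf (f ^~ w)) + 1) => N; apply: contrapT => H.
suff : (limn_einf (f ^~ w) + 1 <= limn_einf (f ^~ w))%E.
  by rewrite -(fineK fw) -EFinD lee_fin gerDl ler10.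
apply: (@einf_ge w _ N) => m Nm; rewrite -(fineK fw) -EFinD lee_fin.
by rewrite leNgt; apply/negP => lt; apply: H; exists m => //; exact: ltW.
Qed.

End Fatou.

(** * From moments to spheres; trees with a core *)

Section Sphere.
Local Open Scope classical_set_scope.
Variables (R : realType) (d : nat) (disp : measure_display)
  (Omega : measurableType disp) (P : probability Omega R) (T : Omega -> rooted_class d).
Hypotheses (mT : measurable_fun [set: Omega] T) (uT : unimodular P T) (d1 : (1 <= d)%N).
Variables (z : R).
Hypotheses (z0 : 0 < z) (z1 : z <= 1) (zq : (d%:R - 1) * z ^+ 2 < 1).

Local Notation lam := (rate d z).

Lemma vfnl_ge0 (U : vfnl R d) (G : cgraph d) x : nice (vlift U) -> vert G x -> 0 <= U G x.
Proof. by move=> nU Gx; apply: (@nice_ge0 _ _ (vlift U) G x x nU); split=> //; left. Qed.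

(** Test functions [u m] which increase to one, but whose moments stay below the rate
    [lam], force the spheres to grow at most like [a^-1]. By Fatou, the sums over [j < m]
    of [(rate a)^-j u_m H^j u_m] at the root stay bounded along a subsequence; as soon as
    [u m] is one at the root and on a given sphere, [sphere_le] applies. *)
Lemma sphere_bound_ae (a : R) (u : nat -> vfnl R d) : 0 < a -> a < z ->
  (forall m, nice (vlift (u m))) ->
  (forall m j, ip P T (u m) (Hiter z j (u m)) <= lam ^+ j) ->
  {ae P, forall w, is_tree (graph_of (T w)) ->
    (forall x, vert (graph_of (T w)) x ->
      exists M, forall m, (M <= m)%N -> u m (graph_of (T w)) x = 1) ->
    exists K, forall n,
      (#|` sphere (graph_of (T w)) (val (root (graph_of (T w)))) n|)%:R * a ^+ n <= K}.
Proof.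
move=> a0 az nu hu; have ra0 := rate_gt0 d1 a0; have rz0 := rate_gt0 d1 z0.
pose t := (rate d a)^-1.
have t0 : 0 <= t by rewrite invr_ge0 ltW.
pose Yj m j : fnl R d := fun G x _ => t ^+ j * (u m G x * Hiter z j (u m) G x).
have nH m j : nice (vlift (Hiter z j (u m))) by apply: nice_Hiter => //; exact: ltW.
have nX m j : nice (vlift (fun G x => u m G x * Hiter z j (u m) G x)) by exact: nice_prod.
have nYj m j : nice (Yj m j).
  by apply: nice_mul; [apply: nice_cst; exact: exprn_ge0|exact: nX].
pose Y m : fnl R d := fun G x y => \sum_(j <- iota 0 m) Yj m j G x y.
have nY m : nice (Y m) by exact: nice_sum.
have rt : 0 <= lam * t < 1.
  by rewrite mulr_ge0 ?(ltW rz0) //= ltr_pdivrMr // mul1r rate_decr.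
have EY m : mean P T (Y m) <= (1 - lam * t)^-1.
  apply: le_trans (geom_sum_le m rt).
  have exsum (s : seq nat) : mean P T (fun G x y => \sum_(j <- s) Yj m j G x y) =
      \sum_(j <- s) mean P T (Yj m j).
    elim: s => [|j s IH].
      rewrite big_nil -[RHS](mean_cst P T 0); apply/esym/mean_ext; first exact: nice_cst.
      by move=> G x _; rewrite big_nil.
    rewrite big_cons -IH -mean_add //; last exact: nice_sum.
    apply/esym/mean_ext; first by apply: nice_add => //; exact: nice_sum.
    by move=> G x _; rewrite big_cons.
  rewrite /Y exsum -[in X in iota 0 X](subn0 m) -/(index_iota 0 m) big_mkord.
  apply: ler_sum => j _; rewrite /Yj mean_scale //; [|exact: exprn_ge0|exact: nX].
  by rewrite exprMn mulrC ler_wpM2r ?exprn_ge0 //; exact: hu.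
have := ae_einf_lt mT nY EY; apply: filterS => w [L hL] tG u1.
set G := graph_of (T w) in tG u1 *; set o := val (root G).
have Go : vert G o by exact: root_vert.
exists L => n; apply: (sphere_le tG d1 a0 az z1 zq Go) => J.
have [M hM] : exists M, forall m, (M <= m)%N -> forall y, y \in o :: sphere G o n -> u m G y = 1.
  have vs : {in o :: sphere G o n, forall y, vert G y}.
    move=> y; rewrite inE => /orP[/eqP -> //|]; rewrite (in_sphere tG) //.
    by move=> /asboolP[].
  elim: (o :: _) vs => [|y s IH] vs; first by exists 0%N.
  have [|M hM] := IH; first by move=> v ys; apply: vs; rewrite inE ys orbT.
  have [M' hM'] := u1 y (vs y (mem_head _ _)).
  exists (maxn M M') => m; rewrite geq_max => /andP[Mm Mm'] v.
  by rewrite inE => /orP[/eqP ->|]; [exact: hM'|exact: hM].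
(* An index at which the test function is one on the sphere and the sums are bounded. *)
have [m Jm Ym] := hL (maxn J M).
move: Jm; rewrite geq_max => /andP[Jm Mm].
apply: le_trans Ym; rewrite (_ : rval (Y m) (T w) = \sum_(j <- iota 0 m) Yj m j G o o) //.
have Hge0 j : 0 <= Hiter z j (u m) G o by exact: vfnl_ge0.
have -> : iota 0 m = iota 0 J ++ iota J (m - J).
  by have := iotaD 0 J (m - J); rewrite subnKC.
rewrite big_cat /=.
apply: ler_wpDr.
  by apply: sumr_ge0 => j _; rewrite !mulr_ge0 ?exprn_ge0 //; exact: vfnl_ge0.
have -> : \sum_(j <- iota 0 J) Yj m j G o o = \sum_(j < J) Yj m j G o o.
  by rewrite -(big_mkord xpredT (fun j => Yj m j G o o)) /index_iota subn0.
apply: ler_sum => j _.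
rewrite /Yj; apply: ler_wpM2l; first exact: exprn_ge0.
rewrite (hM _ Mm o (mem_head _ _)) mul1r.
apply: Hiter_le => //; first exact: ltW.
move=> v Gv; have [vS|vS] := boolP (v \in sphere G o n).
  rewrite hM ?inE ?vS ?orbT // (big_fsetD1 v) //= {1}/delta eqxx big1_seq ?addr0 //.
  by move=> y; rewrite !inE /delta => /andP[_ /andP[yv _]]; rewrite eq_sym (negbTE yv).
rewrite big1_seq; first exact: vfnl_ge0.
by move=> y /andP[_ ys]; rewrite /delta; case: eqP => // e; move: vS; rewrite e ys.
Qed.

(** The power [(1 + H)^m V], positive at every vertex within distance [m] of a vertex
    where [V] is positive. *)
Fixpoint spread (V : vfnl R d) (m : nat) : vfnl R d :=
  if m is m'.+1 then fun G x => spread V m' G x + Hop d z G (spread V m' G) x else V.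

Lemma nice_spread V m : nice (vlift V) -> nice (vlift (spread V m)).
Proof.
move=> nV; elim: m => [//|m IH] /=.
by apply: nice_add => //; apply: nice_Hop IH; exact: ltW.
Qed.

Lemma spread_ge V m n (G : cgraph d) x : nice (vlift V) -> vert G x -> (m <= n)%N ->
  spread V m G x <= spread V n G x.
Proof.
move=> nV Gx mn; rewrite -(subnKC mn); elim: (n - m)%N => [|k IH]; first by rewrite addn0.
rewrite addnS /=; apply: le_trans IH _; rewrite lerDl.
by apply: (vfnl_ge0 (nice_Hop (ltW z0) (nice_spread (m + k) nV))).
Qed.

Lemma spread_adj V m (G : cgraph d) x y : nice (vlift V) -> adj G x y ->
  spread V m G y <= spread V m.+1 G x.
Proof.
move=> nV xy /=; have Gx := adj_vert xy.
have nS := nice_spread m nV.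
have yx : y \in nb G x by rewrite (in_nb (@cgraph_degree _ G)).
rewrite /Hop (big_fsetD1 y) //= addrCA -!addrA lerDl addr_ge0 //.
  rewrite big_seq sumr_ge0 // => w; rewrite !inE (in_nb (@cgraph_degree _ G)).
  by move=> /andP[_ /adj_vertr]; exact: vfnl_ge0.
rewrite addr_ge0 //; first exact: vfnl_ge0.
rewrite !mulr_ge0 ?(ltW z0) ?subr_ge0 ?ler_nat ?(card_nb (@cgraph_degree _ G)) //.
exact: vfnl_ge0.
Qed.

Lemma spread_dist V (G : cgraph d) x y : is_tree G -> nice (vlift V) -> vert G x -> vert G y ->
  V G y <= spread V (dist G x y) G x.
Proof.
move=> tG nV Gx Gy; have [p xp] := upath_ex tG Gx Gy.
rewrite (dist_upath tG xp); elim: p x {Gx} xp => [|b p IH] x xp.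
  by case: xp => _ _ /= ->.
have [xb _ bp] := upath_behead xp.
by apply: le_trans (IH b bp) _; exact: spread_adj.
Qed.

Lemma spread_moments U m : nice (vlift U) ->
  (forall j, ip P T U (Hiter z j U) <= lam ^+ j) ->
  exists2 C, 0 <= C & forall j, ip P T (spread U m) (Hiter z j (spread U m)) <= C * lam ^+ j.
Proof.
move=> nU hU; have l0 := rate_gt0 d1 z0.
elim: m => [|m [C C0 IH]]; first by exists 1 => // j; rewrite mul1r.
exists (C * (1 + lam) ^+ 2); first by rewrite mulr_ge0 // exprn_ge0 // addr_ge0 // ltW.
move=> j; set V := spread U m in IH *.
have nV : nice (vlift V) by exact: nice_spread.
have nH i : nice (vlift (Hiter z i V)) by apply: nice_Hiter => //; exact: ltW.
have -> : ip P T (spread U m.+1) (Hiter z j (spread U m.+1)) =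
    ip P T V (Hiter z j V) + 2 * ip P T V (Hiter z j.+1 V) + ip P T V (Hiter z j.+2 V).
  have -> : spread U m.+1 = fun G x => V G x + Hiter z 1 V G x by [].
  have -> : Hiter z j (fun G x => V G x + Hiter z 1 V G x) =
      (fun G x => Hiter z j V G x + Hiter z j.+1 V G x).
    apply/funext => G; apply/funext => x; rewrite /Hiter iterHopD; congr (_ + _).
    by rewrite -[in RHS]addn1 iterD.
  have nHj : nice (vlift (fun G x => Hiter z j V G x + Hiter z j.+1 V G x)).
    exact: nice_add (nH j) (nH j.+1).
  rewrite (ipDl P mT nV (nH 1%N) nHj) (ipDr P mT nV (nH j) (nH j.+1)).
  rewrite (ipDr P mT (nH 1%N) (nH j) (nH j.+1)).
  rewrite (ip_Hiter mT uT (ltW z0) 1 j nV) (ip_Hiter mT uT (ltW z0) 1 j.+1 nV) !add1n.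
  lra.
have := IH j; have := IH j.+1; have := IH j.+2; rewrite !exprS expr0 mulr1.
move: (lam ^+ j) => L; lra.
Qed.

Definition damping (j : nat) : fnl R d :=
  fun G x _ => (1 + (lam ^+ j)^-1 * Hiter z j (@core R d) G x)^-1.

(** The core, damped so that [seed * H^j core <= lam^j] holds at every vertex and for all
    [j] at once; it is positive exactly at the core vertices where [H^j core] grows at
    most like [lam^j]. *)
Definition seed : vfnl R d := fun G x => core R G x * finf damping G x x.

Let lX j : 0 <= (lam ^+ j)^-1.
Proof. by rewrite invr_ge0 exprn_ge0 // ltW // rate_gt0. Qed.

Lemma nice_seed : nice (vlift seed).
Proof.
apply: nice_mul; first exact: nice_core.
apply: nice_finf => j.
apply: nice_inv1D; apply: nice_mul; first exact: nice_cst.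
by apply: nice_Hiter; [exact: ltW|exact: nice_core].
Qed.

Lemma nice_Hcore j : nice (vlift (Hiter z j (@core R d))).
Proof. by apply: nice_Hiter; [exact: ltW|exact: nice_core]. Qed.

Lemma seed_lbound (G : cgraph d) x : vert G x ->
  lbound (range (fun j => damping j G x x)) 0.
Proof.
move=> Gx _ [j _ <-]; rewrite invr_ge0 addr_ge0 // mulr_ge0 //.
exact: vfnl_ge0 (nice_Hcore j) Gx.
Qed.

Lemma seed_moments j : ip P T seed (Hiter z j seed) <= lam ^+ j.
Proof.
rewrite -[leRHS](mean_cst P T); have l0 := rate_gt0 d1 z0.
have nHs : nice (vlift (Hiter z j seed)) by apply: nice_Hiter; [exact: ltW|exact: nice_seed].
apply: mean_le => //; first exact: nice_prod nice_seed nHs.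
  by apply: nice_cst; rewrite exprn_ge0 // ltW.
move=> G x Gx; rewrite /vlift.
have h0 := vfnl_ge0 (nice_Hcore j) Gx.
have c0 (v : nat) : 0 <= core R G v <= 1 by rewrite clamp_ge0 clamp_le1.
have inf_le v k : vert G v -> finf damping G v v <= damping k G v v.
  by move=> Gv; apply: ge_inf; [exists 0; exact: seed_lbound|exists k].
have inf_ge v : vert G v -> 0 <= finf damping G v v.
  move=> Gv; apply: lb_le_inf; last exact: seed_lbound.
  by exists (damping 0 G v v); exists 0%N.
have le_core v : vert G v -> seed G v <= core R G v.
  move=> Gv; rewrite /seed; have /andP[h h'] := c0 v.
  rewrite ler_piMr //; apply: le_trans (inf_le v 0%N Gv) _.
  have t0 : 0 <= (lam ^+ 0)^-1 * Hiter z 0 (@core R d) G v.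
    by rewrite mulr_ge0 //; exact: vfnl_ge0 (nice_Hcore 0) Gv.
  by rewrite invf_le1 ?lerDl // ltr_pwDl.
apply: (@le_trans _ _ ((1 + (lam ^+ j)^-1 * Hiter z j (@core R d) G x)^-1 *
    Hiter z j (@core R d) G x)).
  apply: ler_pM; [exact: vfnl_ge0 nice_seed Gx|exact: vfnl_ge0 nHs Gx| |].
    rewrite /seed; have /andP[h h'] := c0 x.
    apply: le_trans (inf_le x j Gx); rewrite ler_piMl //; exact: inf_ge.
  by apply: Hiter_le => //; exact: ltW.
have lj : 0 < lam ^+ j by rewrite exprn_gt0.
rewrite mulrC ler_pdivrMr; last by rewrite ltr_pwDl // mulr_ge0.
by rewrite mulrDr mulr1 mulrA mulfV ?gt_eqF // mul1r lerDr ltW.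
Qed.

(** These functions are at most one and increase to one as soon as [seed] does not
    vanish on the tree. Each of them is at most a multiple of a power of [1 + H] applied to
    [seed], so its moments grow no faster; [moments_le] then removes the constants, which
    depend on [m]. *)
Definition visible (m : nat) : vfnl R d := fun G x => Num.min 1 (m%:R * spread seed m G x).

Lemma nice_visible m : nice (vlift (visible m)).
Proof.
apply: nice_min; first exact: nice_cst ler01.
by apply: nice_mul; [exact: nice_cst|exact: nice_spread nice_seed].
Qed.

Lemma visible_moments m j : ip P T (visible m) (Hiter z j (visible m)) <= lam ^+ j.
Proof.
have l0 := rate_gt0 d1 z0.
have [C C0 hC] := spread_moments m nice_seed seed_moments.
have nS := nice_spread m nice_seed.
have nm := nice_mul (nice_cst d (ler0n R m)) nS.
apply: (moments_le mT uT (ltW z0) l0 (C := m%:R ^+ 2 * C)) => [||{}j].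
- exact: nice_visible.
- by move=> G x _; rewrite /visible ge_min lexx.
have nH := nice_Hiter j (ltW z0) nS.
apply: (@le_trans _ _ (ip P T (fun G x => m%:R * spread seed m G x)
    (Hiter z j (fun G x => m%:R * spread seed m G x)))).
  apply: ip_le => //; try exact: nice_visible; try exact: nm.
  - by apply: nice_Hiter; [exact: ltW|exact: nice_visible].
  - by apply: nice_Hiter => //; exact: ltW.
  - by move=> G x _; rewrite /visible ge_min lexx orbT.
  - move=> G x Gx; apply: Hiter_le => //; first exact: ltW.
    by move=> v _; rewrite /visible ge_min lexx orbT.
rewrite /ip (_ : vlift _ = fun G x y => m%:R ^+ 2 *
  vlift (fun G x => spread seed m G x * Hiter z j (spread seed m) G x) G x y); last first.
  apply/funext => G; apply/funext => x; apply/funext => y.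
  by rewrite /vlift /Hiter iterHopZ expr2 mulrACA.
rewrite mean_scale ?exprn_ge0 //; last exact: nice_prod.
apply: le_trans (ler_wpM2l _ (hC j)) _; first exact: exprn_ge0.
by rewrite mulrA.
Qed.

Lemma visible_eventually (G : cgraph d) y C : is_tree G -> in_core G y ->
  (forall j, Hiter z j (@core R d) G y <= C * lam ^+ j) ->
  forall x, vert G x -> exists M, forall m, (M <= m)%N -> visible m G x = 1.
Proof.
move=> tG cy hC x Gx; have Gy := cy.1; have l0 := rate_gt0 d1 z0.
have C0 : 0 <= C.
  by have := hC 0%N; rewrite expr0 mulr1; apply: le_trans; exact: vfnl_ge0 (nice_Hcore 0) Gy.
have sy : (1 + C)^-1 <= seed G y.
  rewrite /seed (core_tree R tG) // asboolT // mul1r; apply: lb_le_inf.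
    by exists (damping 0 G y y); exists 0%N.
  move=> _ [j _ <-].
  have h0 := vfnl_ge0 (nice_Hcore j) Gy.
  rewrite lef_pV2 ?posrE ?ltr_pwDl // ?mulr_ge0 // lerD2l.
  by rewrite ler_pdivrMl ?exprn_gt0 // mulrC.
have i0 : 0 < (1 + C)^-1 by rewrite invr_gt0 ltr_pwDl.
exists (maxn (dist G x y) (Num.bound (1 + C))) => m.
rewrite geq_max => /andP[Dm Bm].
rewrite /visible min_l //.
apply: (@le_trans _ _ (m%:R * (1 + C)^-1)).
  rewrite ler_pdivlMr ?ltr_pwDl // mul1r.
  apply: (@le_trans _ _ (Num.bound (1 + C))%:R); last by rewrite ler_nat.
  by apply/ltW/archi_boundP; rewrite addr_ge0.
rewrite ler_wpM2l //; apply: le_trans sy _.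
apply: le_trans (spread_dist tG nice_seed Gx Gy) _.
exact: spread_ge nice_seed Gx Dm.
Qed.

End Sphere.

(** * Trees without a core *)

Section Coreless.
Local Open Scope classical_set_scope.
Variables (R : realType) (d : nat) (disp : measure_display)
  (Omega : measurableType disp) (P : probability Omega R) (T : Omega -> rooted_class d).
Hypotheses (mT : measurable_fun [set: Omega] T) (uT : unimodular P T) (d1 : (1 <= d)%N).
Variables (z : R).
Hypotheses (z0 : 0 < z) (z1 : z <= 1).

Local Notation lam := (rate d z).

Definition coreless : vfnl R d := fun G x =>
  finf (fun m G x _ => clamp (1 - spread z (@core R d) m G x)) G x x.

Lemma nice_coreless : nice (vlift coreless).
Proof.
apply: (nice_finf (Fn := fun m G x _ => clamp (1 - spread z (@core R d) m G x))) => m.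
apply: nice_clampB; first exact: nice_cst ler01.
exact: (nice_spread z0 m (nice_core R d)).
Qed.

Lemma coreless1 (G : cgraph d) x : is_tree G -> vert G x ->
  (forall y, ~ in_core G y) -> coreless G x = 1.
Proof.
move=> tG Gx nc; rewrite /coreless /finf.
suff -> : (fun m => clamp (1 - spread z (@core R d) m G x)) = (fun=> 1).
  suff -> : range (fun _ : nat => 1 : R) = [set 1] by rewrite inf1.
  by apply/seteqP; split=> [_ [n _ <-]//|_ ->]; exists 0%N.
apply/funext => m; suff -> : spread z (@core R d) m G x = 0 by rewrite subr0 clamp1.
elim: m x Gx => [|m IH] x Gx /=; first by rewrite (core_tree R tG) // asboolF.
rewrite IH // add0r /Hop big1_seq ?add0r ?IH ?mulr0 // => w /andP[_].
by rewrite (in_nb (@cgraph_degree _ G)) => /adj_vertr; exact: IH.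
Qed.

Lemma coreless0 (G : cgraph d) x y : is_tree G -> vert G x -> in_core G y ->
  coreless G x = 0.
Proof.
move=> tG Gx cy; have Gy := cy.1.
have lb : lbound (range (fun m => clamp (1 - spread z (@core R d) m G x))) 0.
  by move=> _ [m _ <-]; exact: clamp_ge0.
apply/eqP; rewrite eq_le; apply/andP; split; last first.
  apply: lb_le_inf lb.
  by exists (clamp (1 - spread z (@core R d) 0 G x)); exists 0%N.
apply: ge_inf; first by exists 0.
exists (dist G x y) => //; apply: clamp0; rewrite subr_le0.
apply: le_trans (spread_dist z0 tG (nice_core R d) Gx Gy).
by rewrite (core_tree R tG) // asboolT.
Qed.

(** The weights of a Schur test. On a tree without core vertices, a function which is
    multiplied by [z^-1] along each step to infinity is a positive eigenfunction of [H]
    with eigenvalue [lam = z^-1 + (d - 1) z]: the parent contributes [z^-1], and the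
    children together with the missing edges contribute [(d - 1) z]. *)
Definition weight (G : cgraph d) (x w : nat) : R :=
  z * fin_side R G x w + z^-1 * fin_side R G w x.

Lemma nice_weight : nice (weight : fnl R d).
Proof.
have zi : 0 <= z^-1 by rewrite invr_ge0 ltW.
apply: nice_add; apply: nice_mul; try exact: nice_fin_side.
- by apply: nice_cst; exact: ltW.
- exact: nice_cst.
- exact: nice_swap (nice_fin_side R d).
Qed.

Lemma two_mul_le (c f g : R) : 0 < c -> 2 * (f * g) <= c * f ^+ 2 + c^-1 * g ^+ 2.
Proof.
move=> c0; rewrite -subr_ge0.
have -> : c * f ^+ 2 + c^-1 * g ^+ 2 - 2 * (f * g) = c^-1 * (c * f - g) ^+ 2.
  have -> : c^-1 * (c * f - g) ^+ 2 =
      (c^-1 * c) * c * f ^+ 2 - 2 * (c^-1 * c) * (f * g) + c^-1 * g ^+ 2.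
    rewrite !expr2; lra.
  by rewrite mulVf ?gt_eqF //; lra.
by rewrite mulr_ge0 ?sqr_ge0 // invr_ge0 ltW.
Qed.

Section OnTree.
Variables (G : cgraph d) (tG : is_tree G).
Hypotheses (iG : infinite_set (vert G)) (nc : forall y, ~ in_core G y).
Let dG := @cgraph_degree d G.

(** The neighbour [a] is the next vertex on the ray from [x] to infinity. *)
Lemma coreless_edges x : vert G x -> exists2 a, a \in nb G x &
  (fin_side R G x a = 1 /\ fin_side R G a x = 0) /\
  forall w, w \in nb G x -> w != a -> fin_side R G x w = 0 /\ fin_side R G w x = 1.
Proof.
move=> Gx; have [a [xa fa fw]] := finite_side_dir tG Gx (nc (y := x)).
have ax : adj G a x by rewrite adj_sym.
exists a; first by rewrite (in_nb dG).
split; first split.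
- by rewrite (fin_side_tree R tG) // asboolT.
- by rewrite (fin_side_tree R tG) // asboolF //; exact: finite_side_asym fa.
move=> w; rewrite (in_nb dG) => xw wa; have wx : adj G w x by rewrite adj_sym.
split; rewrite (fin_side_tree R tG) //; last by rewrite asboolT //; exact: fw.
by rewrite asboolF //; apply: finite_side_asym wx _ => //; exact: fw.
Qed.

Lemma Hop_sq_le (f : nat -> R) x : vert G x ->
  Hop d z G f x ^+ 2 <= lam * (\sum_(w <- nb G x) weight G x w * f w ^+ 2 +
    z * (d%:R - (#|` nb G x|)%:R) * f x ^+ 2).
Proof.
move=> Gx; have [a xa [[a1 a0] wE]] := coreless_edges Gx.
have l0 : 0 < lam by exact: rate_gt0.
have zi0 : 0 < z^-1 by rewrite invr_gt0.
have nd : 0 <= d%:R - (#|` nb G x|)%:R :> R by rewrite subr_ge0 ler_nat (card_nb dG).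
have nE : \sum_(w <- (nb G x `\ a)%fset) z = ((#|` nb G x|)%:R - 1) * z.
  rewrite big_const_seq count_predT iter_addr_0 -[z *+ _]mulr_natl; congr (_ * _).
  by have := cardfsD1 a (nb G x); rewrite xa /= => ->; rewrite natrD addrC addKr.
set g := Hop d z G f x; set h := g / lam.
have ghl : g ^+ 2 = lam * (2 * (g * h)) - lam * (h * g).
  by rewrite /h expr2 !mulrA; have := mulfV (lt0r_neq0 l0); nra.
rewrite ghl -mulrBr ler_pM2l // lerBlDr.
have gl : g = lam * h by rewrite /h mulrC divfK ?gt_eqF.
have hg : h * g = lam * h ^+ 2 by rewrite [in LHS]gl expr2; lra.
pose e := z * (d%:R - (#|` nb G x|)%:R).
have e0 : 0 <= e by rewrite mulr_ge0 // ltW.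
have lamE : lam = z^-1 + ((#|` nb G x|)%:R - 1) * z + e by rewrite /e /rate; lra.
(* Split each product [f w * h] with the weight of [w]; the coefficients of [h ^+ 2] add
   up to [lam]. *)
have Ta : 2 * (f a * h) <= z * f a ^+ 2 + z^-1 * h ^+ 2 by exact: two_mul_le.
have Tx : e * (2 * (f x * h)) <= e * f x ^+ 2 + e * h ^+ 2.
  by have := @two_mul_le 1 (f x) h ltr01; rewrite invr1 !mul1r -mulrDr; exact: ler_wpM2l.
have Tw : \sum_(w <- (nb G x `\ a)%fset) 2 * (f w * h) <=
    \sum_(w <- (nb G x `\ a)%fset) weight G x w * f w ^+ 2 + ((#|` nb G x|)%:R - 1) * z * h ^+ 2.
  rewrite -nE mulr_suml -big_split /= big_seq [leRHS]big_seq; apply: ler_sum => w.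
  rewrite !inE => /andP[wa xw]; have [e1 e2] := wE w xw wa.
  rewrite /weight e1 e2 mulr0 add0r mulr1.
  by have := @two_mul_le z^-1 (f w) h zi0; rewrite invrK.
have gE : 2 * (g * h) = 2 * (f a * h) + \sum_(w <- (nb G x `\ a)%fset) 2 * (f w * h) +
    e * (2 * (f x * h)).
  by rewrite /g /Hop (big_fsetD1 a) //= -mulr_sumr -mulr_suml /e; lra.
rewrite gE hg [\sum_(w <- nb G x) _](big_fsetD1 a) //= {1}/weight a1 a0 mulr1 mulr0 addr0 -/e.
rewrite [in X in _ <= _ + X * _]lamE.
move: Ta Tx Tw; set S1 := \sum_(w <- _) _; set S2 := \sum_(w <- _) _.
move: (h ^+ 2) => hh; lra.
Qed.

Lemma weight_sum_le x : vert G x ->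
  \sum_(w <- nb G x) weight G w x + z * (d%:R - (#|` nb G x|)%:R) = lam.
Proof.
move=> Gx; have [a xa [[a1 a0] wE]] := coreless_edges Gx.
rewrite (big_fsetD1 a) //= (eq_big_seq (fun=> z)); last first.
  move=> w; rewrite !inE => /andP[wa xw]; have [e1 e2] := wE w xw wa.
  by rewrite /weight e1 e2 mulr1 mulr0 addr0.
rewrite /weight a1 a0 mulr0 mulr1 add0r.
rewrite big_const_seq count_predT iter_addr_0 -[z *+ _]mulr_natl /rate.
have -> : (#|` (nb G x `\ a)%fset|)%:R = (#|` nb G x|)%:R - 1 :> R.
  by have := cardfsD1 a (nb G x); rewrite xa /= => ->; rewrite natrD addrC addKr.
lra.
Qed.

End OnTree.

Lemma Hiter_coreless0 (G : cgraph d) x y j : is_tree G -> vert G x -> in_core G y ->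
  Hiter z j coreless G x = 0.
Proof.
move=> tG Gx cy; apply/eqP; rewrite eq_le; apply/andP; split.
  rewrite -[leRHS](iterHop0 d z j G x); apply: Hiter_le => //; first exact: ltW.
  by move=> u Gu; rewrite (coreless0 tG Gu cy).
exact: vfnl_ge0 (nice_Hiter j (ltW z0) nice_coreless) Gx.
Qed.

Hypotheses (treeT : {ae P, forall w, is_tree (graph_of (T w))})
  (infT : {ae P, forall w, infinite_set (vert (graph_of (T w)))}).

(** On the coreless trees, [H] has norm at most [lam]: integrate the pointwise bound
    [Hop_sq_le], and move the weights from the neighbours to the root by mass transport,
    where they add up to [lam]. *)
Lemma coreless_step j :
  ip P T (Hiter z j.+1 coreless) (Hiter z j.+1 coreless) <=
  lam ^+ 2 * ip P T (Hiter z j coreless) (Hiter z j coreless).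
Proof.
set f := Hiter z j coreless; set g := Hiter z j.+1 coreless.
have l0 : 0 < lam by exact: rate_gt0.
have nf : nice (vlift f) by exact: nice_Hiter (ltW z0) nice_coreless.
have ng : nice (vlift g) by exact: nice_Hiter (ltW z0) nice_coreless.
pose F : fnl R d := fun G x y => weight G x y * f G y ^+ 2.
pose E : fnl R d := fun G x _ => z * (d%:R - (#|` nb G x|)%:R) * f G x ^+ 2.
have nF : nice F by exact: nice_mul nice_weight (nice_other_end (nice_prod nf nf)).
have nE : nice E.
  apply: nice_mul (nice_prod nf nf); apply: nice_mul; first exact/nice_cst/ltW.
  exact: nice_degree_defect.
have nFE : nice (fun G x y => nsum F G x y + E G x y) by exact: nice_add (nice_nsum nF) nE.
have nFE' : nice (fun G x y => nsum (swap F) G x y + E G x y).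
  exact: nice_add (nice_nsum (nice_swap nF)) nE.
have step1 : ip P T g g <= lam * mean P T (fun G x y => nsum F G x y + E G x y).
  rewrite -(mean_scale P mT (ltW l0) nFE); apply: (mean_le_ae mT); first exact: nice_prod.
    by apply: nice_mul nFE; exact/nice_cst/ltW.
  move: treeT infT; apply: filterS2 => w tG iG; rewrite /rval /vlift.
  set G := repr (T w) in tG iG *; set o := val (root G).
  have Go : vert G o by exact: root_vert.
  have [[y cy]|nc] := pselect (exists y, in_core G y).
    rewrite /g (Hiter_coreless0 j.+1 tG Go cy) mul0r mulr_ge0 ?(ltW l0) //.
    exact: nice_ge0 nFE (linked_root _).
  by apply: Hop_sq_le => // y cy; apply: nc; exists y.
have step2 : mean P T (fun G x y => nsum (swap F) G x y + E G x y) <= lam * ip P T f f.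
  rewrite -(mean_scale P mT (ltW l0) (nice_prod nf nf)); apply: (mean_le_ae mT) => //.
    by apply: nice_mul (nice_prod nf nf); exact/nice_cst/ltW.
  move: treeT infT; apply: filterS2 => w tG iG; rewrite /rval /vlift.
  set G := repr (T w) in tG iG *; set o := val (root G).
  have Go : vert G o by exact: root_vert.
  rewrite /nsum /swap /F /E -mulr_suml -mulrDl -expr2.
  have [[y cy]|nc] := pselect (exists y, in_core G y).
    by rewrite /f (Hiter_coreless0 j tG Go cy) expr0n /= !mulr0.
  by rewrite weight_sum_le // => y cy; apply: nc; exists y.
apply: le_trans step1 _; rewrite expr2 -mulrA ler_pM2l //; apply: le_trans step2.
rewrite (mean_add P mT (nice_nsum nF) nE) (mean_add P mT (nice_nsum (nice_swap nF)) nE).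
by rewrite (mean_mass_transport mT uT nF).
Qed.

Lemma coreless_moments j : ip P T coreless (Hiter z j coreless) <= lam ^+ j.
Proof.
have l0 : 0 < lam by exact: rate_gt0.
apply: (moments_of_even mT uT (ltW z0) l0 nice_coreless) => {}j.
elim: j => [|j IH].
  rewrite -[leRHS](mean_cst P T); apply: mean_le => //.
  - exact: nice_prod nice_coreless nice_coreless.
  - exact: nice_cst ler01.
  move=> G x Gx; rewrite /vlift /=.
  have c1 : coreless G x <= 1.
    apply: (@le_trans _ _ (clamp (1 - spread z (@core R d) 0 G x))); last exact: clamp_le1.
    apply: ge_inf; last by exists 0%N.
    by exists 0 => _ [m _ <-]; exact: clamp_ge0.
  by rewrite mulr_ile1 // (vfnl_ge0 nice_coreless).
apply: le_trans (coreless_step j) _.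
rewrite (_ : (j.+1 + j.+1)%N = (2 + (j + j))%N); last by lia.
by rewrite exprD ler_wpM2l // exprn_ge0 // ltW.
Qed.

End Coreless.

(** * Growth of the tree and of its spine *)

Section TreeGrowth.
Local Open Scope classical_set_scope.
Variables (R : realType) (d : nat) (G : cgraph d) (tG : is_tree G).
Let dG := @cgraph_degree d G.

Lemma card_ball_spheres x n : vert G x ->
  (#|` fset_set (ball G x n)| <= \sum_(k < n.+1) #|` sphere G x k|)%N.
Proof.
move=> Gx; elim: n => [|n IH].
  rewrite big_ord1 fsubset_leq_card //; apply/fsubsetP => y.
  rewrite in_fset_set; last exact: ball_finite dG x 0%N.
  move=> /set_mem/(ballP tG _ _ Gx)[Gy]; rewrite leqn0 => /eqP d0.
  by rewrite (in_sphere tG) // asboolT.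
rewrite big_ord_recr /=; apply: (@leq_trans #|` fset_set (ball G x n) `|` sphere G x n.+1|%fset).
  apply/fsubset_leq_card/fsubsetP => y; rewrite !inE.
  rewrite (in_fset_set (ball_finite dG x n)) (in_fset_set (ball_finite dG x n.+1)).
  move=> /set_mem/(ballP tG _ _ Gx)[Gy]; rewrite leq_eqVlt => /orP[/eqP e|lt].
    by apply/orP; right; rewrite (in_sphere tG) // asboolT.
  by apply/orP; left; apply/mem_set/ballP.
by rewrite cardfsU; apply: leq_trans (leq_subr _ _) _; rewrite leq_add2r.
Qed.

Lemma card_ball_shift x y n : vert G x -> vert G y ->
  (#|` fset_set (ball G y n)| <= #|` fset_set (ball G x (dist G x y + n))|)%N.
Proof.
move=> Gx Gy; apply/fsubset_leq_card/fsubsetP => v.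
rewrite (in_fset_set (ball_finite dG y n)) (in_fset_set (ball_finite dG x _)).
move=> /set_mem/(ballP tG _ _ Gy)[Gv yv]; apply/mem_set/ballP => //; split=> //.
by apply: leq_trans (dist_triangle tG Gx Gy Gv) _; rewrite leq_add2l.
Qed.

Lemma growth_from_le_spheres (s K : R) x y : 1 < s -> vert G x -> vert G y ->
  (forall n, (#|` sphere G x n|)%:R * s^-1 ^+ n <= K) -> (growth_from R G y <= s%:E)%E.
Proof.
move=> s1 Gx Gy hK; have s0 : 0 < s by exact: lt_trans ltr01 s1.
have K0 : 0 <= K by apply: le_trans (hK 0%N); rewrite mulr_ge0 // exprn_ge0 // invr_ge0 ltW.
rewrite growth_fromE; apply: (@exp_growth_le _ _ (K * s / (s - 1) * s ^+ dist G x y)) => // n.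
apply: (@le_trans _ _ (#|` fset_set (ball G x (dist G x y + n))|)%:R).
  by rewrite ler_nat card_ball_shift.
rewrite -mulrA -exprD; move: (_ + n)%N => m.
apply: (@le_trans _ _ (\sum_(k < m.+1) #|` sphere G x k|)%N%:R).
  by rewrite ler_nat card_ball_spheres.
rewrite natr_sum; apply: (@le_trans _ _ (\sum_(k < m.+1) K * s ^+ k)).
  apply: ler_sum => k _; have := hK k.
  by rewrite exprVn ler_pdivrMr // exprn_gt0.
rewrite -mulr_sumr -!mulrA ler_wpM2l // mulrCA ler_pdivlMl ?subr_gt0 //.
by rewrite -subrX1 exprS lerBlDr lerDl.
Qed.

Lemma growth_from_finite x : vert G x -> finite_set (vert G) -> (growth_from R G x <= 1%:E)%E.
Proof.
move=> Gx fG; rewrite growth_fromE.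
apply: (@exp_growth_le _ _ (#|` fset_set (vert G)|)%:R) => // n.
rewrite expr1n mulr1 ler_nat; apply/fsubset_leq_card/fsubsetP => v.
rewrite !in_fset_set //; last exact: ball_finite dG _ _.
by move=> /set_mem/ball_vert Gv; exact/mem_set.
Qed.

Lemma growth_from_spine_le (s : R) x y : 0 < s -> vert G x -> vert G y ->
  (growth_from R G x < s%:E)%E -> (growth_from R (spine G) y <= s%:E)%E.
Proof.
move=> s0 Gx Gy; rewrite !growth_fromE => /(exp_growth_lt s0)[C hC].
apply: (@exp_growth_le _ _ (C * s ^+ dist G x y)) => // n.
rewrite -mulrA -exprD; apply: le_trans (hC _); rewrite ler_nat.
apply: leq_trans (card_ball_shift n Gx Gy); apply/fsubset_leq_card/fsubsetP => v.
have fS : finite_set (ball (spine G) y n).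
  by apply: sub_finite_set (ball_finite dG y n); exact: spine_ball_sub.
rewrite !in_fset_set //; last exact: ball_finite dG _ _.
by move=> /set_mem/spine_ball_sub Gv; exact/mem_set.
Qed.

(** Balls of the spine around [y] are the traces on the core of balls of the tree. *)
Lemma core_iter_le (s0 s : R) y : (1 <= d)%N -> infinite_set (vert G) -> in_core G y ->
  0 < s0 -> s0 < s -> 1 <= s -> (growth_from R (spine G) y < s0%:E)%E ->
  exists C, forall j, Hiter s^-1 j (@core R d) G y <= C * rate d s^-1 ^+ j.
Proof.
move=> d1 iG cy s00 s0s s1; rewrite growth_fromE => /(exp_growth_lt s00)[C hC].
have sp : 0 < s by exact: lt_le_trans ltr01 s1.
exists (C / (1 - s0 * s^-1)) => j.
apply: (iterHop_indic_le tG d1 (A := in_core G)) => //.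
- by rewrite invr_gt0.
- by rewrite invf_le1.
- exact: ltW.
- by rewrite ltr_pdivrMr // mul1r.
- exact: cy.1.
- by move=> u _; exact: clamp_le1.
- by move=> u Gu nu; rewrite (core_tree R tG) // asboolF.
move=> n; apply: le_trans (hC n); rewrite ler_nat; apply/fsubset_leq_card/fsubsetP => v.
have fS : finite_set (ball (spine G) y n).
  by apply: sub_finite_set (ball_finite dG y n); exact: spine_ball_sub.
rewrite !in_fset_set //; last by apply: finite_setIr; exact: ball_finite dG _ _.
move=> /set_mem[cv /(ballP tG _ _ cy.1)[Gv yv]]; apply/mem_set.
exact: (core_spine_ball dG tG iG cy cv yv).
Qed.

End TreeGrowth.

Lemma ereal_rat_between (R : realType) (r : R) (x y : \bar R) : (r%:E <= x)%E -> (x < y)%E ->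
  exists q : rat, (x < (ratr q)%:E)%E /\ ((ratr q)%:E < y)%E.
Proof.
case: x => [x| |] // _; last by case: y.
case: y => [y| |] // => [xy|_].
  have [q] := rat_in_itvoo (xy : x < y).
  by rewrite in_itv /= => /andP[xq qy]; exists q; rewrite !lte_fin.
have /rat_in_itvoo[q] : x < x + 1 by rewrite ltrDl.
by rewrite in_itv /= => /andP[xq _]; exists q; rewrite lte_fin ltry.
Qed.

Lemma get_vert (G : sgraph) x : vert G x -> vert G (get (vert G)).
Proof. by move=> Gx; apply: getPex; exists x. Qed.

Lemma sqrt_pred_ge1 (R : realType) d : (2 <= d)%N -> 1 <= Num.sqrt (d%:R - 1 : R).
Proof.
move=> hd; have h : (2 : R) <= d%:R by rewrite ler_nat.
by rewrite -[leLHS]sqrtr1 ler_wsqrtr //; lra.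
Qed.

Section AlmostSureGrowth.
Local Open Scope classical_set_scope.
Variables (R : realType) (d : nat) (hd : (2 <= d)%N) (disp : measure_display)
  (Omega : measurableType disp) (P : probability Omega R) (T : Omega -> rooted_class d).
Hypotheses (mT : measurable_fun [set: Omega] T) (uT : unimodular P T)
  (treeT : {ae P, forall w, is_tree (graph_of (T w))})
  (growthT : {ae P, forall w,
    ((Num.sqrt (d%:R - 1))%:E < upper_growth R (graph_of (T w)))%E}).

Let d1 : (1 <= d)%N. Proof. exact: ltnW. Qed.

(** A finite graph has growth at most one, and [sqrt (d - 1)] is at least one. *)
Lemma infinite_ae : {ae P, forall w, infinite_set (vert (graph_of (T w)))}.
Proof.
move: treeT growthT; apply: filterS2 => w tG gr fG.
move: gr; rewrite ltNge => /negP; apply.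
apply: le_trans (growth_from_finite R _ fG) _; last by rewrite lee_fin sqrt_pred_ge1.
by apply: get_vert; exact: root_vert.
Qed.

(** The two cases in which the growth of the tree is controlled by the rate of [s]: an
    empty spine, or a spine which is visited at most at that rate. *)
Definition slow_core (s : R) (G : cgraph d) : Prop :=
  (forall y, ~ in_core G y) \/
  exists2 y, in_core G y & exists C, forall j,
    Hiter s^-1 j (@core R d) G y <= C * rate d s^-1 ^+ j.

Lemma slow_core_growth_ae (s s' : R) : Num.sqrt (d%:R - 1) < s -> s < s' ->
  {ae P, forall w, slow_core s (graph_of (T w)) ->
    (upper_growth R (graph_of (T w)) <= s'%:E)%E}.
Proof.
move=> qs ss'; have s1 : 1 < s by exact: le_lt_trans (sqrt_pred_ge1 R hd) qs.
have s0 : 0 < s by exact: lt_trans ltr01 s1.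
have s'1 : 1 < s' by exact: lt_trans ss'.
have s'0 : 0 < s' by exact: lt_trans ss'.
have z0 : 0 < s^-1 by rewrite invr_gt0.
have z1 : s^-1 <= 1 by rewrite invf_le1 // ltW.
have zq : (d%:R - 1) * s^-1 ^+ 2 < 1.
  rewrite exprVn ltr_pdivrMr ?exprn_gt0 // mul1r.
  rewrite -[ltLHS]sqr_sqrtr; last by rewrite subr_ge0 ler1n.
  by rewrite ltrXn2r // ?sqrtr_ge0.
have a0 : 0 < s'^-1 by rewrite invr_gt0.
have az : s'^-1 < s^-1 by rewrite ltf_pV2.
have sp := sphere_bound_ae (P := P) mT d1 z0 z1 zq a0 az.
have := sp (fun=> coreless s^-1) (fun=> nice_coreless d z0)
  (fun=> coreless_moments mT uT d1 z0 z1 treeT infinite_ae).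
have := sp _ (nice_visible d1 z0) (visible_moments mT uT d1 z0).
move=> A B; move: A B treeT; apply: filterS3 => w.
set G := graph_of (T w) => vis cless tG.
have Go : vert G (val (root G)) by exact: root_vert.
have Gg := get_vert Go.
move=> [nc|[y cy [C hC]]].
  have [x Gx|K hK] := cless tG; last exact: (growth_from_le_spheres tG s'1 Go Gg hK).
  by exists 0%N => m _; exact: coreless1.
have [x Gx|K hK] := vis tG; last exact: (growth_from_le_spheres tG s'1 Go Gg hK).
exact: (visible_eventually d1 z0 tG cy hC).
Qed.

End AlmostSureGrowth.

Theorem theorem3 (R : realType) (d : nat) (hd : (2 <= d)%N)
    (disp : measure_display) (Omega : measurableType disp)
    (P : probability Omega R) (T : Omega -> rooted_class d)
    (mT : measurable_fun [set: Omega]%classic T)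
    (uT : unimodular P T)
    (treeT : {ae P, forall w, is_tree (graph_of (T w))})
    (growthT : {ae P, forall w,
      ((Num.sqrt (d%:R - 1))%:E < upper_growth R (graph_of (T w)))%E}) :
  {ae P, forall w,
    upper_growth R (spine (graph_of (T w))) = upper_growth R (graph_of (T w))}.
Proof.
pose Q (s s' : R) w := Num.sqrt (d%:R - 1) < s -> s < s' ->
  slow_core s (graph_of (T w)) -> (upper_growth R (graph_of (T w)) <= s'%:E)%E.
(* Countably many pairs of rates suffice: encode pairs of rationals by numbers. *)
have aeQ : {ae P, forall w, forall n : nat,
    if @choice.unpickle (rat * rat)%type n is Some p
    then Q (ratr p.1) (ratr p.2) w else True}.
  apply: ae_foralln => n; case: (choice.unpickle n) => [[r r']|]; last exact: aeW.
  have [qr|nqr] := pselect (Num.sqrt (d%:R - 1) < ratr r :> R); last first.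
    by apply: aeW => w /nqr.
  have [rr|nrr] := pselect (ratr r < ratr r' :> R); last by apply: aeW => w _ /nrr.
  by apply: filterS (slow_core_growth_ae hd mT uT treeT growthT qr rr) => w Qw _ _.
have treeI : {ae P, forall w, is_tree (graph_of (T w)) /\
    infinite_set (vert (graph_of (T w)))}.
  by move: treeT (infinite_ae hd treeT growthT); apply: filterS2 => w; split.
move: aeQ growthT treeI; apply: filterS3 => w {}aeQ gr [tG iG].
have hQ (r r' : rat) : Q (ratr r) (ratr r') w.
  by have := aeQ (choice.pickle (r, r')); rewrite choice.pickleK.
move: tG iG gr hQ; rewrite /Q; set G := graph_of (T w) => tG iG gr hQ.
set g : R := Num.sqrt (d%:R - 1) in gr hQ.
have Go : vert G (val (root G)) by exact: root_vert.
have Gg := get_vert Go.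
have dG := @cgraph_degree _ G.
(* An empty core bounds the growth by every [r'] above [sqrt (d - 1)]. *)
have core_ex : exists y, in_core G y.
  apply: contrapT => nc.
  have [r [gr1 gr2]] := ereal_rat_between (lexx g%:E) gr.
  have [r' [r1 r2]] := ereal_rat_between (lexx (ratr r)%:E) gr2.
  move: r2; rewrite ltNge => /negP; apply; apply: (hQ r r').
  - by rewrite lte_fin in gr1.
  - by rewrite lte_fin in r1.
  - by left=> y cy; apply: nc; exists y.
have [y0 cy0] := core_ex.
have Sy := get_vert (core_spine dG tG iG cy0).
set y := get (vert (spine G)) in Sy.
have cy := spine_core Sy.
have spine_le : (upper_growth R (spine G) <= upper_growth R G)%E.
  rewrite leNgt; apply/negP => lt.
  have [r [r1 r2]] := ereal_rat_between (ltW gr) lt.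
  have r0 : 0 < ratr r :> R.
    have := lt_trans gr r1; rewrite lte_fin; apply: le_lt_trans; exact: sqrtr_ge0.
  move: r2; rewrite ltNge => /negP; apply.
  exact: (growth_from_spine_le tG r0 Gg cy.1 r1).
apply: le_anti; apply/andP; split; first exact: spine_le.
rewrite leNgt; apply/negP => lt.
have mlt : (Order.max g%:E (upper_growth R (spine G)) < upper_growth R G)%E.
  by rewrite gt_max gr lt.
(* Three rationals above the growth of the spine and below that of the tree: the spine is
   slower than [r0], so the core is visited at the rate of [r], and the tree is slower than
   [r'], a contradiction. *)
have gm : (g%:E <= Order.max g%:E (upper_growth R (spine G)))%E by rewrite le_max lexx.
have [r0 [a0 b0]] := ereal_rat_between gm mlt.
have [r [a1 b1]] := ereal_rat_between (lexx (ratr r0)%:E) b0.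
have [r' [a2 b2]] := ereal_rat_between (lexx (ratr r)%:E) b1.
move: a0; rewrite gt_max lte_fin => /andP[gr0 sr0]; rewrite !lte_fin in a1 a2.
move: b2; rewrite ltNge => /negP; apply; apply: (hQ r r') => //.
  exact: lt_trans gr0 a1.
have r00 : 0 < ratr r0 :> R by apply: le_lt_trans gr0; exact: sqrtr_ge0.
right; exists y => //; apply: (core_iter_le tG (ltnW hd) iG cy r00 a1) => //.
by apply/ltW/(le_lt_trans (sqrt_pred_ge1 R hd))/(lt_trans gr0).
Qed.
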